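(* Let $X$ be a compact metric space with metric $d$, let $T:X\to X$ be continuous, let $g$ be a mistake function, and let $\mathcal{F}=\{f_n\}_{n\ge 1}\subseteq C(X)$ be an asymptotically sub-additive potential. Let $\mu$ be an ergodic $T$-invariant Borel probability measure on $X$ with $\mathcal{F}_*(\mu)\neq-\infty$. Then for every $\delta\in(0,1)$, $$P_\mu(g;T,\mathcal{F})=\lim_{\epsilon\to0}\liminf_{n\to\infty}\frac1n\log P_\mu(g;T,\mathcal{F},n,\epsilon,\delta)=h_\mu(T)+\mathcal{F}_*(\mu).$$ The formula remains true if $\liminf_{n\to\infty}$ is replaced by $\limsup_{n\to\infty}$. In particular, the value $\lim_{\epsilon\to0}\liminf_{n\to\infty}\frac1n\log P_\mu(g;T,\mathcal{F},n,\epsilon,\delta)$ (respectively with $\limsup$) is independent of $\delta\in(0,1)$ and of the mistake function $g$.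
   Context: $C(X)$ is the space of continuous functions $X\to\mathbb{R}$, and $\|f\|=\max_{x\in X}|f(x)|$. $h_\mu(T)$ is the measure-theoretic (Kolmogorov–Sinai) entropy. Asymptotically sub-additive potential: a sequence $\mathcal{F}=\{f_n\}_{n\ge1}\subseteq C(X)$ such that for each $k>0$ there is a sub-additive sequence $\Phi_k=\{\varphi_n^k\}_{n\ge1}\subseteq C(X)$, i.e. $\varphi_{n+m}^k(x)\le\varphi_n^k(x)+\varphi_m^k(T^nx)$ for all $x\in X$ and $n,m\ge1$, with $\limsup_{n\to\infty}\frac1n\|f_n-\varphi_n^k\|\le\frac1k$. For a $T$-invariant Borel probability measure $\mu$ put $\mathcal{F}_*(\mu)=\lim_{n\to\infty}\frac1n\int f_n\,d\mu\in[-\infty,\infty)$ (this limit is known to exist). Mistake function: given $\epsilon_0>0$, a function $g:\mathbb{N}\times(0,\epsilon_0]\to\mathbb{N}$ such that for all $\epsilon\in(0,\epsilon_0]$ and all $n\in\mathbb{N}$, $g(n,\epsilon)\le g(n+1,\epsilon)$ and $\lim_{n\to\infty}g(n,\epsilon)/n=0$. For $\epsilon>\epsilon_0$ set $g(n,\epsilon)=g(n,\epsilon_0)$. For a finite set $\Lambda$ of non-negative integers, $d_\Lambda(x,y)=\max\{d(T^ix,T^iy):i\in\Lambda\}$ (with $d_\emptyset=0$) and $B_\Lambda(x,\epsilon)=\{y\in X:d_\Lambda(x,y)<\epsilon\}$. Put $I(g;n,\epsilon)=\{\Lambda\subseteq\{0,1,\dots,n-1\}:\#\Lambda\ge n-g(n,\epsilon)\}$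 and define the mistake dynamical ball $B_n(g;x,\epsilon)=\bigcup_{\Lambda\in I(g;n,\epsilon)}B_\Lambda(x,\epsilon)$. For $\delta>0$, a set $S\subseteq X$ is a $(g;n,\epsilon,\delta)$-spanning set (for $\mu$) if $\mu\big(\bigcup_{x\in S}B_n(g;x,\epsilon)\big)>1-\delta$. Define $$P_\mu(g;T,\mathcal{F},n,\epsilon,\delta)=\inf\Big\{\sum_{x\in S}\exp\Big[\sup_{y\in B_n(g;x,\epsilon)}f_n(y)\Big]: S\text{ is a }(g;n,\epsilon,\delta)\text{-spanning set}\Big\},$$ $$P_\mu(g;T,\mathcal{F})=\lim_{\delta\to0}\lim_{\epsilon\to0}\liminf_{n\to\infty}\frac1n\log P_\mu(g;T,\mathcal{F},n,\epsilon,\delta).$$ *)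

(* Defs.v *)
From HB Require Import structures.
From mathcomp Require Import all_boot all_order all_algebra.
From mathcomp Require Import all_classical all_reals all_analysis.
Import Order.TTheory GRing.Theory Num.Theory.
Import numFieldNormedType.Exports.

Set Implicit Arguments.
Unset Strict Implicit.
Unset Printing Implicit Defensive.

Local Open Scope classical_set_scope.
Local Open Scope ring_scope.

(* The library's measurable types are pointed, so the Borel sigma-algebra of a
   metric space needs a base point.  A space carrying a probability measure is
   nonempty, so nothing is lost. *)
#[short(type="pmetricType")]
HB.structure Definition PointedMetric (R : numDomainType) :=
  {X of Pointed X & Metric R X}.

Notation borel X := (g_sigma_algebraType (@open X)).

Section Dynamics.
Context {R : realType} {X : pmetricType R}.
Implicit Types (T : X -> X) (mu : probability (borel X) R).
Implicit Types (f phi : nat -> X -> R) (g : nat -> R -> nat).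

Definition invariant_measure T mu : Prop :=
  forall A : set (borel X), measurable A -> mu (T @^-1` A) = mu A.

Definition ergodic_measure T mu : Prop :=
  invariant_measure T mu /\
  forall A : set (borel X), measurable A -> T @^-1` A = A ->
    mu A = 0%E \/ mu A = 1%E.

Definition measurable_partition k (A : 'I_k -> set (borel X)) : Prop :=
  (forall i, measurable (A i)) /\ partition [set: 'I_k] A [set: X].

(* The cell of the join of the T^-i A, i < n, with itinerary w; the itineraries
   that never occur give empty cells, which contribute 0 to the entropy. *)
Definition join_cell T k (A : 'I_k -> set (borel X)) n (w : {ffun 'I_n -> 'I_k})
    : set (borel X) :=
  [set x | forall i : 'I_n, A (w i) (iter i T x)].

Definition join_entropy T mu k (A : 'I_k -> set (borel X)) n : R :=
  \sum_(w : {ffun 'I_n -> 'I_k})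
    (let p := fine (mu (join_cell T A w)) in - (p * ln p)).

Definition partition_entropy T mu k (A : 'I_k -> set (borel X)) : \bar R :=
  limn (fun n => (n%:R^-1 * join_entropy T mu A n)%:E).

Definition ks_entropy T mu : \bar R :=
  ereal_sup [set h | exists k (A : 'I_k -> set (borel X)),
    measurable_partition A /\ h = partition_entropy T mu A].

Definition supnorm (u : X -> R) : R := sup [set `|u x| | x in [set: X]].

(* Sequences are indexed by n >= 1; the term of index 0 is unconstrained, both
   here and in mistake_function. *)
Definition subadditive_potential T phi : Prop :=
  (forall n, (0 < n)%N -> continuous (phi n)) /\
  forall n m x, (0 < n)%N -> (0 < m)%N ->
    phi (n + m)%N x <= phi n x + phi m (iter n T x).

Definition asymp_subadditive_potential T f : Prop :=
  (forall n, (0 < n)%N -> continuous (f n)) /\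
  forall k : nat, (0 < k)%N -> exists phi,
    subadditive_potential T phi /\
    (limn_esup (fun n => (n%:R^-1 * supnorm (f n \- phi n))%:E)
       <= (k%:R^-1)%:E)%E.

Definition Fstar mu f : \bar R :=
  limn (fun n => (n%:R^-1)%:E * \int[mu]_(x in [set: borel X]) (f n x)%:E)%E.

Definition mistake_function (eps0 : R) g : Prop :=
  0 < eps0 /\
  forall eps, 0 < eps <= eps0 ->
    (forall n, (0 < n)%N -> (g n eps <= g n.+1 eps)%N) /\
    (fun n => (g n eps)%:R / n%:R : R) @ \oo --> (0 : R).

Definition mistake_ext (eps0 : R) g : nat -> R -> nat :=
  fun n eps => g n (Num.min eps eps0).

Definition dist_on T n (L : {set 'I_n}) (x y : X) : R :=
  \big[Num.max/0]_(i in L) mdist (iter i T x) (iter i T y).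

Definition ball_on T n (L : {set 'I_n}) (x : X) (eps : R) : set (borel X) :=
  [set y | dist_on T L x y < eps].

Definition mistake_index g n eps : set {set 'I_n} :=
  [set L : {set 'I_n} | (n - g n eps <= #|L|)%N].

Definition mistake_ball T g (n : nat) (x : X) (eps : R) : set (borel X) :=
  \bigcup_(L in @mistake_index g n eps) ball_on T L x eps.

Definition spanning T mu g n (eps delta : R) (S : set X) : Prop :=
  ((1 - delta)%:E < mu (\bigcup_(x in S) mistake_ball T g n x eps))%E.

Definition spanning_pressure T mu f g n (eps delta : R) : \bar R :=
  ereal_inf [set \esum_(x in S)
      expeR (ereal_sup [set (f n y)%:E | y in mistake_ball T g n x eps])
    | S in [set S | spanning T mu g n eps delta S]].

(* In the next three definitions Lim is limn_einf or limn_esup. *)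
Definition pressure_rate (Lim : (nat -> \bar R) -> \bar R) T mu f g
    (delta eps : R) : \bar R :=
  Lim (fun n => (n%:R^-1)%:E * lne (spanning_pressure T mu f g n eps delta))%E.

Definition pressure_delta Lim T mu f g (delta : R) : \bar R :=
  lim (pressure_rate Lim T mu f g delta eps @[eps --> 0^'+]).

Definition measure_pressure Lim T mu f g : \bar R :=
  lim (pressure_delta Lim T mu f g delta @[delta --> 0^'+]).

End Dynamics.

(* Main.v *)
Require Import Defs.
From HB Require Import structures.
From mathcomp Require Import all_boot all_order all_algebra.
From mathcomp Require Import all_classical all_reals all_analysis.
From mathcomp Require Import measurable_realfun.
From mathcomp Require Import ring lra zify.
Set Implicit Arguments.
Unset Strict Implicit.
Unset Printing Implicit Defensive.
Import Order.TTheory GRing.Theory Num.Theory.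
Import numFieldNormedType.Exports.
Local Open Scope classical_set_scope.
Local Open Scope ring_scope.

(* Two facts hold in measure, and both come from the same argument.  If bounded
   functions v_n satisfy v_n <= (1/m) sum_(i < n) v_m o T^i + C_m up to an error
   of bounded mean, then Birkhoff averages of v_m / m bound v_n / n from above,
   while the means of v_n / n, whose limit is their infimum, force it to be
   concentrated at that limit.  This applies to the subadditive approximations
   of the potential (no error term) and to the information functions
   I_n = - ln mu(A_n(x)) of a finite partition A.  For the latter, compare mu
   with the measures for which blocks of length m are independent and use
   E (ln (q / p))^+ <= E (q / p) <= 1.  The ergodic theorem itself is needed only
   in measure, and follows from the maximal inequality.

   Upper bound: take a partition of mesh < eps and one point in each cell of
   A_n that is not too small and contains a point with a typical ergodic sum;
   along a mistake ball the ergodic sum of a continuous function changes by at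
   most n omega(eps) + 2 g(n, eps) sup |psi|.

   Lower bound: off a set V of small measure, points close to each other lie in
   the same atom of A.  Two points of a mistake ball whose orbits rarely visit V
   therefore have itineraries at Hamming distance at most a small multiple of n,
   so the typical part of a mistake ball meets at most exp(n e) cells of A_n,
   each of measure at most exp(-n (h - e)).  No approximation of A by partitions
   with null boundary is needed. *)

(** * Expectation of bounded measurable functions *)

Section expectation.
Context d (X : measurableType d) (R : realType) (mu : probability X R).
Implicit Types (u v : X -> R) (A B : set X) (T : X -> X) (c : R).

(** The functions to be integrated are continuous on a compact space or take finitely many values.
    Everywhere boundedness covers both and is stable under sums, maxima and composition with [T], so
    integrability is automatic. *)
Definition bounded_measurable u : Prop :=
  measurable_fun setT u /\ exists C, forall x, `|u x| <= C.

Notation bm := bounded_measurable.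

Definition expect u : R := \int[mu]_x u x.
Definition prob A : R := fine (mu A).

Notation E := expect.
Notation P := prob.

Lemma bm_fun u : bm u -> measurable_fun setT u. Proof. by case. Qed.

Lemma bm_integrable u : bm u -> mu.-integrable setT (EFin \o u).
Proof.
move=> [mu_ [C uC]]; apply: measurable_bounded_integrable => //.
  by rewrite (le_lt_trans (probability_le1 mu measurableT))// ltry.
exists C; split; first by rewrite num_real.
by move=> M CM x _ /=; rewrite (le_trans (uC x))// ltW.
Qed.

Lemma bm_cst c : bm (fun=> c).
Proof. by split; [exact: measurable_cst | exists `|c|]. Qed.

Lemma bmD u v : bm u -> bm v -> bm (fun x => u x + v x).
Proof.
move=> [mu_ [C uC]] [mv [D vD]]; split; first exact: measurable_funD.
by exists (C + D) => x; rewrite (le_trans (ler_normD _ _))// lerD.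
Qed.

Lemma bmZ c u : bm u -> bm (fun x => c * u x).
Proof.
move=> [mu_ [C uC]]; split.
  by apply: measurable_funM => //; exact: measurable_cst.
by exists (`|c| * C) => x; rewrite normrM ler_wpM2l.
Qed.

Lemma bmN u : bm u -> bm (fun x => - u x).
Proof. by move=> /(bmZ (-1)); under eq_fun do rewrite mulN1r. Qed.

Lemma bmB u v : bm u -> bm v -> bm (fun x => u x - v x).
Proof. by move=> bu /bmN bv; exact: bmD. Qed.

Lemma bm_max u v : bm u -> bm v -> bm (fun x => Num.max (u x) (v x)).
Proof.
move=> [mu_ [C uC]] [mv [D vD]]; split; first exact: measurable_maxr.
exists (Num.max C D) => x; rewrite le_max.
by have [_|_] := leP (u x) (v x); rewrite ?uC ?vD ?orbT.
Qed.

Lemma bm_comp T u : measurable_fun setT T -> bm u -> bm (u \o T).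
Proof.
move=> mT [mu_ [C uC]]; split; first exact: measurableT_comp.
by exists C => x /=; exact: uC.
Qed.

Lemma bm_indic A : measurable A -> bm (\1_A : X -> R).
Proof.
move=> mA; split; first exact: measurable_indic.
by exists 1 => x; rewrite indicE ger0_norm ?ler0n// lern1 leq_b1.
Qed.

Lemma bm_sum I (s : seq I) (u : I -> X -> R) : (forall i, bm (u i)) ->
  bm (fun x => \sum_(i <- s) u i x).
Proof.
move=> bu; elim: s => [|i s ih].
  by under eq_fun do rewrite big_nil; exact: bm_cst.
by under eq_fun do rewrite big_cons; exact: bmD.
Qed.

Lemma expect_cst c : E (fun=> c) = c.
Proof.
by rewrite /expect Rintegral_cst// -[X in fine X]/(mu setT) probability_setT mulr1.
Qed.

Lemma expectD u v : bm u -> bm v -> E (fun x => u x + v x) = E u + E v.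
Proof. by move=> /bm_integrable bu /bm_integrable bv; exact: RintegralD. Qed.

Lemma expectB u v : bm u -> bm v -> E (fun x => u x - v x) = E u - E v.
Proof. by move=> /bm_integrable bu /bm_integrable bv; exact: RintegralB. Qed.

Lemma expectZ c u : bm u -> E (fun x => c * u x) = c * E u.
Proof. by move=> /bm_integrable bu; exact: RintegralZl. Qed.

Lemma le_expect u v : bm u -> bm v -> (forall x, u x <= v x) -> E u <= E v.
Proof.
by move=> /bm_integrable bu /bm_integrable bv uv; apply: le_Rintegral => // x _.
Qed.

Lemma expect_sum I (s : seq I) (u : I -> X -> R) : (forall i, bm (u i)) ->
  E (fun x => \sum_(i <- s) u i x) = \sum_(i <- s) E (u i).
Proof.
move=> bu; elim: s => [|i s ih].
  by rewrite big_nil -[RHS](expect_cst 0); congr E; apply/funext => x; rewrite big_nil.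
rewrite big_cons -ih -expectD//; last exact: bm_sum.
by congr E; apply/funext => x; rewrite big_cons.
Qed.

Lemma expect_indic A : measurable A -> E (\1_A) = P A.
Proof. by move=> mA; rewrite /expect /Rintegral integral_indic// setIT. Qed.

Lemma prob_ge0 A : 0 <= P A. Proof. exact: fine_ge0. Qed.

Lemma probE A : measurable A -> mu A = (P A)%:E.
Proof.
by move=> mA; rewrite /P fineK// fin_num_measure.
Qed.

Lemma prob_le1 A : measurable A -> P A <= 1.
Proof. by move=> mA; rewrite -lee_fin -probE// probability_le1. Qed.

Lemma prob0 : P set0 = 0.
Proof. by rewrite /P measure0. Qed.

Lemma le_prob A B : measurable A -> measurable B -> A `<=` B -> P A <= P B.
Proof.
by move=> mA mB AB; rewrite -lee_fin -!probE// le_measure// inE.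
Qed.

Lemma probC A : measurable A -> P (~` A) = 1 - P A.
Proof.
move=> mA; apply: EFin_inj; rewrite EFinB -!probE//; last exact: measurableC.
exact: probability_setC.
Qed.

Lemma probU A B : measurable A -> measurable B -> P (A `|` B) <= P A + P B.
Proof.
move=> mA mB; rewrite -lee_fin EFinD -!probE//; last exact: measurableU.
exact: measureU2.
Qed.

Lemma markov u c A : bm u -> (forall x, 0 <= u x) -> measurable A ->
  (forall x, A x -> c <= u x) -> c * P A <= E u.
Proof.
move=> bu u0 mA Au; rewrite -expect_indic// -expectZ; last exact: bm_indic.
apply: le_expect => //; first by apply: bmZ; exact: bm_indic.
move=> x; rewrite indicE; have [/set_mem/Au|_] := boolP (x \in A).
  by rewrite mulr1.
by rewrite mulr0.
Qed.

Lemma measurable_le u v : measurable_fun setT u -> measurable_fun setT v ->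
  measurable [set x | u x <= v x].
Proof. by move=> mu_ mv; rewrite -[X in measurable X]setTI; exact: measurable_fun_le. Qed.

Lemma measurable_lt u v : measurable_fun setT u -> measurable_fun setT v ->
  measurable [set x | u x < v x].
Proof.
move=> mu_ mv; rewrite [X in measurable X](_ : _ = ~` [set x | v x <= u x]).
  by apply: measurableC; exact: measurable_le.
by apply/seteqP; split => x /=; rewrite ltNge => /negP.
Qed.

Lemma bm_lt c u : bm u -> measurable [set x | c < u x].
Proof. by case=> mu_ _; apply: measurable_lt => //; exact: measurable_cst. Qed.

Lemma expect_comp T u : measurable_fun setT T ->
  (forall A, measurable A -> mu (T @^-1` A) = mu A) -> bm u ->
  E (u \o T) = E u.
Proof.
move=> mT invT bu; have bT := bm_comp mT bu; rewrite /expect /Rintegral; congr fine.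
rewrite -[LHS](@integral_pushforward _ _ _ _ _ _ mT mu setT (EFin \o u))//.
- by apply: eq_measure_integral => A mA _; exact: invT.
- by apply/measurable_EFinP; case: bu.
- by rewrite preimage_setT; exact: bm_integrable bT.
Qed.

End expectation.

(** * The ergodic theorem *)

Section ergodic_sums.
Context (R : realType) (X : Type) (T : X -> X).
Implicit Types (u : X -> R) (c : R).

Definition bsum u n x : R := \sum_(i < n) u (iter i T x).

Lemma bsum0 u x : bsum u 0 x = 0. Proof. by rewrite /bsum big_ord0. Qed.

Lemma bsumS u n x : bsum u n.+1 x = u x + bsum u n (T x).
Proof.
rewrite /bsum big_ord_recl; congr (_ + _).
by apply: eq_bigr => i _; rewrite /bump -iterSr.
Qed.

Lemma bsumZ c u n x : bsum (fun y => c * u y) n x = c * bsum u n x.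
Proof. by rewrite /bsum mulr_sumr. Qed.

Lemma bsumB_cst u c n x : bsum (fun y => u y - c) n x = bsum u n x - n%:R * c.
Proof. by rewrite /bsum sumrB sumr_const card_ord mulr_natl. Qed.

End ergodic_sums.

Section birkhoff.
Context d (X : measurableType d) (R : realType) (mu : probability X R).
Context (T : X -> X) (mT : measurable_fun setT T).
Hypothesis invT : forall A : set X, measurable A -> mu (T @^-1` A) = mu A.
Implicit Types (u v : X -> R) (A B : (set X)^nat) (a c : R).

Notation bm := (@bounded_measurable _ X R).
Notation E := (expect mu).
Notation P := (prob mu).
Notation bsum := (bsum T).

(** Index 0 is left out because the term of index 0 of a potential is unconstrained and need not be
    measurable. *)
Definition vanishing A : Prop :=
  (forall n, (0 < n)%N -> measurable (A n)) /\
  forall e, 0 < e -> \forall n \near \oo, P (A n) < e.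

Lemma vanishing_sub A B : (forall n, (0 < n)%N -> measurable (A n)) ->
  (\forall n \near \oo, A n `<=` B n) -> vanishing B -> vanishing A.
Proof.
move=> mA AB [mB vB]; split=> // e e0; near=> n.
apply: (@le_lt_trans _ _ (P (B n))); last by near: n; exact: vB.
apply: le_prob; [apply: mA|apply: mB|by near: n]; near: n; exact: nbhs_infty_gt.
Unshelve. all: by end_near. Qed.

Lemma vanishingU A B : vanishing A -> vanishing B ->
  vanishing (fun n => A n `|` B n).
Proof.
move=> [mA vA] [mB vB]; split=> [n n0|e e0].
  by apply: measurableU; [exact: mA|exact: mB].
near=> n; have n0 : (0 < n)%N by near: n; exact: nbhs_infty_gt.
rewrite (le_lt_trans (probU _ (mA n n0) (mB n n0)))// (splitr e) ltrD//.
  by near: n; apply: vA; rewrite divr_gt0.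
by near: n; apply: vB; rewrite divr_gt0.
Unshelve. all: by end_near. Qed.

Lemma measurable_iter n : measurable_fun setT (iter n T).
Proof. by elim: n => [|n ih]; [exact: measurable_id|exact: measurableT_comp]. Qed.

Lemma bm_iter u n : bm u -> bm (fun x => u (iter n T x)).
Proof. by apply: bm_comp; exact: measurable_iter. Qed.

Lemma expect_iter u n : bm u -> E (fun x => u (iter n T x)) = E u.
Proof.
move=> bu; elim: n => [//|n ih]; rewrite -ih.
rewrite -[RHS](expect_comp mT invT); last exact: bm_iter.
by congr E; apply/funext => x /=; rewrite -iterSr.
Qed.

Lemma bm_bsum u n : bm u -> bm (bsum u n).
Proof. by move=> bu; apply: bm_sum => i; exact: bm_iter. Qed.

Lemma expect_bsum u n : bm u -> E (bsum u n) = n%:R * E u.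
Proof.
move=> bu; rewrite expect_sum; last by move=> i; exact: bm_iter.
rewrite (eq_bigr (fun=> E u)); last by move=> i _; exact: expect_iter.
by rewrite sumr_const card_ord mulr_natl.
Qed.

(* The maximum of the [bsum u k] for [k <= n]. *)
Fixpoint maxsum u n x : R :=
  if n is n'.+1 then Num.max 0 (u x + maxsum u n' (T x)) else 0.

Lemma maxsum_ge0 u n x : 0 <= maxsum u n x.
Proof. by case: n => //= n; rewrite le_max lexx. Qed.

Lemma maxsum_leS u n x : maxsum u n x <= maxsum u n.+1 x.
Proof.
elim: n x => [|n ih] x; first exact: maxsum_ge0.
by rewrite /= ge_max !le_max lexx /= lerD2l ih orbT.
Qed.

Lemma maxsum_nd u m n x : (m <= n)%N -> maxsum u m x <= maxsum u n x.
Proof.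
by move=> /subnK <-; elim: (n - m)%N => // k; move/le_trans; apply; exact: maxsum_leS.
Qed.

Lemma bsum_le_maxsum u n x : bsum u n x <= maxsum u n x.
Proof.
elim: n x => [|n ih] x; first by rewrite bsum0.
by rewrite bsumS /= le_max lerD2l ih orbT.
Qed.

Lemma bm_maxsum u n : bm u -> bm (maxsum u n).
Proof.
move=> bu; elim: n => [|n ih]; first exact: bm_cst.
by apply: bm_max; [exact: bm_cst|apply: bmD => //; exact: (bm_comp mT ih)].
Qed.

(* Garsia's argument: [maxsum u n x <= u x + maxsum u n (T x)] wherever the left
   side is positive. *)
Lemma maximal_ergodic u C n : bm u -> (forall x, `|u x| <= C) ->
  0 <= E u + C * (1 - P [set x | 0 < maxsum u n x]).
Proof.
move=> bu uC; set A := [set x | _].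
have bM := bm_maxsum n bu.
have mA : measurable A by exact: bm_lt.
have bMT : bm (maxsum u n \o T) by exact: bm_comp.
have bA := @bm_indic _ X R _ mA.
have bA1 : bm (fun x => 1 - \1_A x : R) by apply: bmB => //; exact: bm_cst.
have bRHS : bm (fun x => u x + C * (1 - \1_A x)) by apply: bmD => //; exact: bmZ.
(* By invariance this difference has mean zero, so a pointwise comparison with the right-hand side
   suffices. *)
have <- : E (fun x => maxsum u n x - (maxsum u n \o T) x) = 0.
  by rewrite expectB// expect_comp// subrr.
have -> : E u + C * (1 - P A) = E (fun x => u x + C * (1 - \1_A x)).
  rewrite expectD//; last exact: bmZ.
  by rewrite expectZ// expectB// ?expect_cst ?expect_indic//; exact: bm_cst.
apply: le_expect => //; first exact: bmB.
move=> x /=; rewrite indicE; have [/set_mem|/negP nAx] := boolP (x \in A).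
  rewrite /A /= subrr mulr0 addr0 => M0; rewrite lerBlDr.
  case: n M0 {bM mA bMT bA bA1 bRHS A} => [|n] /=; first by rewrite ltxx.
  rewrite lt_max ltxx/= => M0; have /= := maxsum_leS u n (T x).
  by rewrite -(lerD2l (u x)) => uM; rewrite ge_max uM (le_trans (ltW M0) uM).
(* Off [A] the difference is at most 0, whereas [u x + C] is at least 0. *)
have -> : maxsum u n x = 0.
  apply/eqP; rewrite eq_le maxsum_ge0 andbT leNgt; apply/negP => M0.
  by apply: nAx; exact: mem_set.
rewrite subr0 mulr1 sub0r (@le_trans _ _ 0)//.
  by rewrite oppr_le0; exact: maxsum_ge0.
by move: (uC x); rewrite ler_norml => /andP[]; lra.
Qed.

(** The sets where [maxsum u n] is positive increase to a set of full measure, so the error term of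
    [maximal_ergodic] tends to 0. *)
Lemma maximal_ergodic_lim u : bm u ->
  mu (\bigcup_n [set x | 0 < maxsum u n x]) = 1%E -> 0 <= E u.
Proof.
move=> bu mu1; have [_ [C uC]] := bu.
have mA n : measurable [set x | 0 < maxsum u n x] by apply: bm_lt; exact: bm_maxsum.
have cvgP : P [set x | 0 < maxsum u n x] @[n --> \oo] --> (1 : R).
  apply: (@fine_cvg _ _ _ _ (fun n => mu [set x | 0 < maxsum u n x])).
  rewrite -[1%:E]mu1; apply: nondecreasing_cvg_mu => //.
    exact: bigcup_measurable.
  by move=> m n mn; apply/subsetPset => x /= /lt_le_trans; apply; exact: maxsum_nd.
suff : (E u + C * (1 - P [set x | 0 < maxsum u n x])) @[n --> \oo] --> E u.
  move=> cvgE; rewrite -(cvg_lim (@Rhausdorff R) cvgE).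
  apply: limr_ge; first by apply/cvg_ex; exists (E u).
  by apply: nearW => n; exact: (maximal_ergodic n bu uC).
rewrite [X in _ --> X](_ : _ = E u + C * (1 - 1)); last first.
  by rewrite subrr mulr0 addr0.
apply: cvgD; [exact: cvg_cst|apply: cvgM; [exact: cvg_cst|]].
by apply: cvgB; [exact: cvg_cst|].
Qed.

Hypothesis ergT : forall A : set X, measurable A -> T @^-1` A = A ->
  mu A = 0%E \/ mu A = 1%E.

(** These sets decrease to the set where the sums are unbounded above, which is invariant. If that
    set had measure 1, the maximal inequality would give [0 <= E u]; hence it is null by
    ergodicity. *)
Lemma bsum_bounded_above u : bm u -> E u < 0 ->
  vanishing (fun k => \bigcup_n [set x | k%:R < bsum u n x]).
Proof.
move=> bu Eu0; have [_ [C uC]] := bu.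
pose B k := \bigcup_n [set x | k%:R < bsum u n x].
have mB k : measurable (B k).
  by apply: bigcup_measurable => n _; apply: bm_lt; exact: bm_bsum.
have mcapB : measurable (\bigcap_k B k) by exact: bigcap_measurable.
(* Passing between [x] and [T x] changes a sum by one value of [u], at most [C] in absolute value;
   raising the threshold from [k] to [k'] absorbs it. *)
have shift k : exists k', k%:R + C <= k'%:R.
  exists (Num.truncn (k%:R + C)).+1; apply: ltW.
  exact: truncnS_gt.
have invB : T @^-1` (\bigcap_k B k) = \bigcap_k B k.
  apply/seteqP; split => x Bx k _.
    have [k' kk'] := shift k; have [n _ /= kn] := Bx k' I.
    exists n.+1 => //=; rewrite bsumS.
    by move: (uC x); rewrite ler_norml => /andP[Cu _]; lra.
  have [k' kk'] := shift k; have [[|n] _ /= kn] := Bx k' I.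
    by move: kn; rewrite bsum0 ltNge ler0n.
  exists n => //=; move: kn; rewrite bsumS.
  by move: (uC x); rewrite ler_norml => /andP[_ Cu]; lra.
have muB : mu (\bigcap_k B k) = 0%E.
  have [//|B1] := ergT mcapB invB.
  suff : 0 <= E u by rewrite leNgt Eu0.
  apply: maximal_ergodic_lim => //; apply/eqP; rewrite eq_le.
  have mM : measurable (\bigcup_n [set x | 0 < maxsum u n x]).
    by apply: bigcup_measurable => n _; apply: bm_lt; exact: bm_maxsum.
  rewrite probability_le1//= -B1 le_measure ?inE//.
  move=> x /(_ 0%N I)[n _ /= un]; exists n => //=.
  by rewrite (lt_le_trans un)// bsum_le_maxsum.
have cvgB : P (B k) @[k --> \oo] --> (0 : R).
  apply: (@fine_cvg _ _ _ _ (mu \o B)); rewrite -[0%:E]muB.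
  apply: nonincreasing_cvg_mu => //.
    by rewrite (le_lt_trans (probability_le1 mu (mB 0%N)))// ltry.
  move=> m n mn; apply/subsetPset => x [k _ /= nk]; exists k => //=.
  by rewrite (le_lt_trans _ nk)// ler_nat.
split=> [n _|e e0]; first exact: mB.
near=> k.
have : `|0 - P (B k)| < e by near: k; apply: cvgr_dist_lt.
by rewrite sub0r normrN ger0_norm// prob_ge0.
Unshelve. all: by end_near. Qed.

(** For [b] strictly between [E u] and [a], the sums of [u - b] stay below a constant off a small
    set, while exceeding [n%:R * a] would push them above [n%:R * (a - b)], which grows without
    bound. *)
Theorem birkhoff_above u a : bm u -> E u < a ->
  vanishing (fun n => [set x | n%:R * a < bsum u n x]).
Proof.
move=> bu Eua; pose b := (E u + a) / 2.
have [Eub ba] : E u < b /\ b < a by split; rewrite /b; lra.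
have bv : bm (fun x => u x - b) by apply: bmB => //; exact: bm_cst.
have Ev0 : E (fun x => u x - b) < 0.
  by rewrite expectB// ?expect_cst ?subr_lt0//; exact: bm_cst.
have [mB vB] := bsum_bounded_above bv Ev0.
have mA n : measurable [set x | n%:R * a < bsum u n x].
  by apply: bm_lt; exact: bm_bsum.
split=> // e e0; have [N _ /(_ N.+1 (leqnSn N)) vK] := vB e e0.
set K := N.+1 in vK.
near=> n; apply: le_lt_trans vK; apply: le_prob => //; first exact: mB.
move=> x /= ax; exists n => //=; rewrite bsumB_cst.
suff : K%:R <= n%:R * (a - b) by lra.
rewrite -ler_pdivrMr ?subr_gt0//; near: n; exact: nbhs_infty_ger.
Unshelve. all: by end_near. Qed.

Theorem birkhoff_below u a : bm u -> a < E u ->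
  vanishing (fun n => [set x | bsum u n x < n%:R * a]).
Proof.
move=> bu aEu; have /birkhoff_above : bm (fun x => -1 * u x) by exact: bmZ.
move=> /(_ (- a)); rewrite expectZ// mulN1r ltrN2 => /(_ aEu).
apply: vanishing_sub.
  move=> n _; apply: measurable_lt; last exact: measurable_cst.
  by apply: bm_fun; exact: bm_bsum.
by apply: nearW => n x /=; rewrite bsumZ mulN1r mulrN ltrN2.
Qed.

End birkhoff.

(** * Almost subadditive sequences *)

Section blocks.
Context (R : realType) (X : Type) (T : X -> X).
Implicit Types (u : X -> R) (phi : nat -> X -> R).

Notation bsum := (bsum T).

Definition block_sum m u n x : R := \sum_(b < n %/ m) u (iter (b * m) T x).

Lemma block_sum_lt m u n x : (n < m)%N -> block_sum m u n x = 0.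
Proof. by move=> nm; rewrite /block_sum divn_small// big_ord0. Qed.

Lemma block_sum_ge m u n x : (0 < m)%N -> (m <= n)%N ->
  block_sum m u n x = u x + block_sum m u (n - m) (iter m T x).
Proof.
move=> m0 mn; have dE : (n %/ m = ((n - m) %/ m).+1)%N.
  by rewrite -{1}(subnK mn) divnDr ?dvdnn// divnn m0 addn1.
rewrite /block_sum dE big_ord_recl; congr (_ + _); apply: eq_bigr => i _.
by rewrite -iterD /bump mulnDl mul1n addnC.
Qed.

(** Every position [i] with [i + m <= n] starts a block for exactly one offset [j < m]; there are
    [n.+1 - m] such positions, none when [n < m]. *)
Lemma sum_block_sum m u n x : (0 < m)%N ->
  \sum_(j < m) block_sum m u (n - j) (iter j T x) = bsum u (n.+1 - m) x.
Proof.
case: m => // m _; elim: n x => [|n ih] x.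
  rewrite subSS sub0n bsum0 big1// => j _.
  by rewrite sub0n block_sum_lt.
rewrite big_ord_recl subn0 (eq_bigr (fun i : 'I_m =>
  block_sum m.+1 u (n - i) (iter i T (T x)))); last first.
  by move=> i _; rewrite lift0 subSS iterSr.
have := ih (T x); rewrite big_ord_recr [iter ord_max _ _]/= -[iter m T (T x)]iterSr.
set A := \sum_(_ < _) _; rewrite [nat_of_ord _]/= => {}ih.
(* The last offset for [T x] is what offset 0 for [x] leaves after its first block; the remaining
   offsets agree after a shift by one. *)
have {}ih : A + block_sum m.+1 u (n - m) (iter m.+1 T x) =
  bsum u (n - m) (T x) := ih.
change (block_sum m.+1 u n.+1 x + A = bsum u (n.+1 - m) x); clearbody A.
have [nm|mn] := ltnP n m.
  rewrite block_sum_lt ?add0r; last by rewrite ltnS.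
  rewrite (_ : n.+1 - m = 0)%N; last by apply/eqP; rewrite subn_eq0.
  rewrite bsum0; move: ih; rewrite (_ : n - m = 0)%N; last first.
    by apply/eqP; rewrite subn_eq0 ltnW.
  by rewrite block_sum_lt// addr0 bsum0.
rewrite block_sum_ge// subSS -addrA [X in _ + X]addrC ih.
by rewrite subSn// bsumS.
Qed.

Lemma bsum_cat u p q x : bsum u (p + q) x = bsum u p x + bsum u q (iter p T x).
Proof.
rewrite /bsum big_split_ord/=; congr (_ + _); apply: eq_bigr => i _.
by rewrite -iterD addnC.
Qed.

Lemma bsum_ge u n x c : (forall y, c <= u y) -> n%:R * c <= bsum u n x.
Proof.
move=> cu; rewrite mulr_natl -[in leLHS](card_ord n) -sumr_const.
exact: ler_sum.
Qed.

(** Cutting off an initial piece of length [j] and then blocks of length [m] gives a bound for each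
    offset [j < m]; their average turns block sums into an ergodic sum. In [4 * K], [2 * K] covers
    the incomplete last block, [K] the initial piece, and [K] the fewer than [m] final terms of the
    ergodic sum, after division by [m]. *)
Lemma subadditive_le_bsum phi m K n x : (0 < m)%N -> (0 < n)%N ->
  (forall p q y, (0 < p)%N -> (0 < q)%N ->
     phi (p + q)%N y <= phi p y + phi q (iter p T y)) ->
  (forall i y, (0 < i <= m)%N -> `|phi i y| <= K) ->
  phi n x <= m%:R^-1 * bsum (phi m) n x + 4 * K.
Proof.
move=> m0 n0 sub phiK.
have K0 : 0 <= K by rewrite (le_trans _ (phiK m x _))// m0 leqnn.
have leK i y : (0 < i <= m)%N -> phi i y <= K.
  by move=> im; rewrite (le_trans (ler_norm _)) ?phiK.
have geK i y : (0 < i <= m)%N -> - K <= phi i y.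
  by move=> im; have := phiK i y im; rewrite ler_norml => /andP[].
have le_block p y : (0 < p)%N -> phi p y <= block_sum m (phi m) p y + 2 * K.
  elim/ltn_ind: p y => p ih y p0; have [pm|mp] := ltnP p m.
    by rewrite block_sum_lt// add0r (le_trans (leK p y _)) ?p0 1?ltnW//; lra.
  (* Subadditivity is only given for positive lengths, so an empty remainder is treated apart. *)
  rewrite block_sum_ge//; have [->|pm] := eqVneq p m.
    by rewrite subnn block_sum_lt//; lra.
  have mltp : (m < p)%N by rewrite ltn_neqAle eq_sym pm.
  rewrite -{1}(subnKC mp) (le_trans (sub _ _ _ _ _))// ?subn_gt0// -addrA lerD2l.
  by apply: ih; rewrite ?subn_gt0// ltn_subrL m0.
have le_offset j : (j < m)%N ->
    phi n x <= block_sum m (phi m) (n - j) (iter j T x) + 3 * K.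
  move=> jm; have [nj|jn] := leqP n j.
    rewrite (eqP (_ : n - j == 0)%N) ?subn_eq0// block_sum_lt//.
    by have := leK n x; rewrite n0 (leq_trans nj (ltnW jm)) => /(_ isT); lra.
  case: j jm jn => [|j] jm jn.
    by rewrite subn0; have := le_block n x n0; rewrite /=; lra.
  rewrite -{1}(subnKC (ltnW jn)) (le_trans (sub _ _ _ _ _))// ?subn_gt0//.
  have := leK j.+1 x; rewrite (ltnW jm) => /(_ isT).
  by have := le_block (n - j.+1)%N (iter j.+1 T x); rewrite subn_gt0 => /(_ jn); lra.
have m0R : (0 : R) < m%:R by rewrite ltr0n.
rewrite -(ler_pM2l m0R) mulrDr mulrA divff ?gt_eqF// mul1r.
have -> : m%:R * phi n x = \sum_(j < m) phi n x.
  by rewrite sumr_const card_ord mulr_natl.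
apply: (@le_trans _ _ (\sum_(j < m)
    (block_sum m (phi m) (n - j) (iter j T x) + 3 * K))).
  by apply: ler_sum => j _; exact: le_offset.
rewrite big_split/= sum_block_sum// sumr_const card_ord -[_ *+ m]mulr_natl.
suff : bsum (phi m) (n.+1 - m) x <= bsum (phi m) n x + m%:R * K by lra.
have pn : (n.+1 - m <= n)%N by rewrite leq_subLR -add1n leq_add2r.
rewrite -{2}(subnKC pn) bsum_cat -addrA lerDl.
have geKm y : - K <= phi m y by apply: geK; rewrite m0/=.
have := bsum_ge (n - (n.+1 - m)) (iter (n.+1 - m) T x) geKm.
have : (n - (n.+1 - m))%:R * K <= m%:R * K.
  rewrite ler_wpM2r// ler_nat leq_subLR -add1n; lia.
lra.
Qed.

End blocks.

(** * Concentration of almost subadditive sequences *)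

Section concentration.
Context d (X : measurableType d) (R : realType) (mu : probability X R).
Context (T : X -> X) (mT : measurable_fun setT T).
Hypothesis invT : forall A : set X, measurable A -> mu (T @^-1` A) = mu A.
Context (v : nat -> X -> R).

Notation bm := (@bounded_measurable _ X R).
Notation E := (expect mu).
Notation bsum := (bsum T).

Hypothesis bv : forall n, (0 < n)%N -> bm (v n).

Hypothesis sub_v : forall m, (0 < m)%N -> exists C, forall n, (m <= n)%N ->
  E (fun x => Num.max 0 (v n x - (m%:R^-1 * bsum (v m) n x + C))) <= 1.

Notation a n := (n%:R^-1 * E (v n)).

Let bm_bsum_v m n : (0 < m)%N -> bm (fun x => m%:R^-1 * bsum (v m) n x).
Proof. by move=> m0; apply: bmZ; apply: bm_bsum => //; exact: bv. Qed.

Let expect_bsum_v m n : (0 < m)%N ->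
  E (fun x => m%:R^-1 * bsum (v m) n x) = n%:R * a m.
Proof.
move=> m0; rewrite expectZ; last by apply: bm_bsum => //; exact: bv.
by rewrite expect_bsum// 1?mulrCA//; exact: bv.
Qed.

Lemma mean_almost_subadditive m : (0 < m)%N -> exists C, forall n, (m <= n)%N ->
  E (v n) <= n%:R * a m + C.
Proof.
move=> m0; have [C subC] := sub_v m0; exists (C + 1) => n mn.
have n0 : (0 < n)%N by exact: leq_trans mn.
have b1 : bm (fun x => m%:R^-1 * bsum (v m) n x + C).
  by apply: bmD; [exact: bm_bsum_v|exact: bm_cst].
have b2 : bm (fun x => Num.max 0 (v n x - (m%:R^-1 * bsum (v m) n x + C))).
  by apply: bm_max; [exact: bm_cst|apply: bmB => //; exact: bv].
apply: (@le_trans _ _ (E (fun x => (m%:R^-1 * bsum (v m) n x + C) +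
    Num.max 0 (v n x - (m%:R^-1 * bsum (v m) n x + C))))).
  apply: le_expect; [exact: bv|exact: bmD|move=> x].
  by rewrite -lerBlDl le_max lexx orbT.
rewrite expectD// expectD ?expect_cst//; [|exact: bm_bsum_v|exact: bm_cst].
by rewrite expect_bsum_v// addrA lerD2l subC.
Qed.

Lemma mean_eventually_le m e : (0 < m)%N -> 0 < e ->
  \forall n \near \oo, a n <= a m + e.
Proof.
move=> m0 e0; have [C EC] := mean_almost_subadditive m0; near=> n.
have n0 : (0 < n)%N by near: n; exact: nbhs_infty_gt.
have n0R : (0 : R) < n%:R by rewrite ltr0n.
rewrite ler_pdivrMl//; apply: (le_trans (EC n _)).
  by near: n; exact: nbhs_infty_ge.
rewrite mulrDr lerD2l -ler_pdivrMr//; near: n; exact: nbhs_infty_ger.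
Unshelve. all: by end_near. Qed.

(** Fekete's argument: for fixed [m] the later means are at most [a m] up to an arbitrarily small
    error, and [a m] can be taken close to the infimum [l]. *)
Lemma mean_cvg_inf l : (forall n, (0 < n)%N -> l <= a n) ->
  (forall e, 0 < e -> exists2 m, (0 < m)%N & a m < l + e) ->
  (fun n => a n) @ \oo --> l.
Proof.
move=> la infl; apply/cvgrPdist_le => e e0.
have [m m0 am] := infl (e / 2) (divr_gt0 e0 (ltr0Sn _ 1)).
have e20 : 0 < e / 2 by rewrite divr_gt0.
near=> n; rewrite distrC ger0_norm; last first.
  by rewrite subr_ge0 la//; near: n; exact: nbhs_infty_gt.
have : a n <= a m + e / 2 by near: n; exact: mean_eventually_le.
lra.
Unshelve. all: by end_near. Qed.

Hypothesis ergT : forall A : set X, measurable A -> T @^-1` A = A ->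
  mu A = 0%E \/ mu A = 1%E.

Context (l : R) (lea : forall n, (0 < n)%N -> l <= a n).
Hypothesis infl : forall e, 0 < e -> exists2 m, (0 < m)%N & a m < l + e.

Let mlt n (c : R) : (0 < n)%N -> measurable [set x | c < v n x].
Proof. by move=> n0; apply: bm_lt; exact: bv. Qed.

Let mgt n (c : R) : (0 < n)%N -> measurable [set x | v n x < c].
Proof.
by move=> n0; apply: measurable_lt; [case: (bv n0)|exact: measurable_cst].
Qed.

(** Take [m] with [a m] close to [l]. Where [v n] exceeds [n%:R * (l + e)], either the ergodic sum
    of [v m / m] is too large, or the excess [D] is at least of order [n]; the latter is rare by
    Markov's inequality, as [D] has mean at most 1. *)
Theorem concentration_above e : 0 < e ->
  vanishing mu (fun n => [set x | n%:R * (l + e) < v n x]).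
Proof.
move=> e0; have [m m0 am] := infl (divr_gt0 e0 (ltr0Sn _ 1)).
have [C subC] := sub_v m0.
have bvm : bm (fun x => m%:R^-1 * v m x) by apply: bmZ; exact: bv.
have Evm : E (fun x => m%:R^-1 * v m x) < l + e / 2.
  by rewrite expectZ//; exact: bv.
have V1 := birkhoff_above mT invT ergT bvm Evm.
split=> [n n0|t t0]; first exact: mlt.
have t20 : 0 < t / 2 by rewrite divr_gt0.
have V1t := V1.2 _ t20.
near=> n.
have n0 : (0 < n)%N by near: n; exact: nbhs_infty_gt.
have n0R : (0 : R) < n%:R by rewrite ltr0n.
have nm : (m <= n)%N by near: n; exact: nbhs_infty_ge.
pose D x := Num.max 0 (v n x - (m%:R^-1 * bsum (v m) n x + C)).
have bD : bm D.
  apply: bm_max; [exact: bm_cst|apply: bmB; first exact: bv].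
  by apply: bmD; [exact: bm_bsum_v|exact: bm_cst].
set A1 := [set x | n%:R * (l + e / 2) < bsum (fun y => m%:R^-1 * v m y) n x].
set A2 := [set x | n%:R * (e / 4) < D x].
have mA1 : measurable A1 by have [+ _] := V1; exact.
have mA2 : measurable A2 by exact: bm_lt.
apply: (@le_lt_trans _ _ (prob mu (A1 `|` A2))).
  apply: le_prob; [exact: mlt|exact: measurableU|move=> x /= vx].
  have [?|Sx] := ltP (n%:R * (l + e / 2)) (bsum (fun y => m%:R^-1 * v m y) n x).
    by left.
  right; rewrite /A2 /= lt_max; apply/orP; right.
  have : C <= n%:R * (e / 4).
    by rewrite -ler_pdivrMr ?divr_gt0//; near: n; exact: nbhs_infty_ger.
  by move: Sx; rewrite bsumZ; lra.
apply: le_lt_trans (probU _ mA1 mA2) _; rewrite [ltRHS]splitr ltr_leD//.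
  by rewrite /A1; near: n; exact: V1t.
have D0 x : 0 <= D x by rewrite le_max lexx.
have := @markov _ _ _ mu D (n%:R * (e / 4)) A2 bD D0 mA2 (fun x => @ltW _ _ _ _).
move=> /le_trans/(_ (subC n nm)); rewrite mulrC -ler_pdivlMr; last first.
  by rewrite mulr_gt0// divr_gt0.
move=> /le_trans; apply.
rewrite ler_pdivrMr ?mulr_gt0// ?divr_gt0//.
rewrite [t / 2 * _]mulrC -mulrA -ler_pdivrMr; last by rewrite !mulr_gt0.
by near: n; exact: nbhs_infty_ger.
Unshelve. all: by end_near. Qed.

(** The comparison function [U] has mean barely above [n l], and [v n] has mean at least [n l] while
    hardly exceeding [U]. So [v n] rarely falls far below [U], and [U] itself is rarely far below
    [n l] by the ergodic theorem. *)
Theorem concentration_below e : 0 < e ->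
  vanishing mu (fun n => [set x | v n x < n%:R * (l - e)]).
Proof.
move=> e0; split=> [n n0|t t0]; first exact: mgt.
(* Markov's inequality at level [n%:R * (e / 2)] turns a mean of twice [n%:R * (e * t / 8)] into
   probability [t / 2]; the second copy absorbs [C + 1]. *)
have et0 : 0 < e * t / 8 by rewrite divr_gt0// mulr_gt0.
have [m m0 am] := infl et0.
have [C' subC'] := sub_v m0; pose C := Num.max 0 C'.
have bvm : bm (fun x => m%:R^-1 * v m x) by apply: bmZ; exact: bv.
have Evm : l - e / 2 < E (fun x => m%:R^-1 * v m x).
  by rewrite expectZ; [have := lea m0; lra|exact: bv].
have V1 := birkhoff_below mT invT ergT bvm Evm.
have t20 : 0 < t / 2 by rewrite divr_gt0.
have V1t := V1.2 _ t20.
near=> n.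
have n0 : (0 < n)%N by near: n; exact: nbhs_infty_gt.
have n0R : (0 : R) < n%:R by rewrite ltr0n.
have nm : (m <= n)%N by near: n; exact: nbhs_infty_ge.
pose U x := m%:R^-1 * bsum (v m) n x + C.
have bU : bm U by apply: bmD; [exact: bm_bsum_v|exact: bm_cst].
have bvn := bv n0.
pose D x := Num.max 0 (v n x - U x).
have bD : bm D by apply: bm_max; [exact: bm_cst|exact: bmB].
have ED : E D <= 1.
  apply: le_trans (subC' n nm); apply: le_expect => //.
    apply: bm_max; [exact: bm_cst|apply: bmB => //].
    by apply: bmD; [exact: bm_bsum_v|exact: bm_cst].
  move=> x; rewrite /D ge_max le_max lexx/= le_max; apply/orP; right.
  by rewrite lerD2l lerN2 /U lerD2l le_max lexx orbT.
(* The positive part of [U - v n] has mean [E U - E (v n) + E D], and [E (v n)]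
   is at least [n l]. *)
pose G x := U x - v n x + D x.
have bG : bm G by apply: bmD => //; exact: bmB.
have G0 x : 0 <= G x.
  by rewrite /G -lerBlDl sub0r opprB le_max lexx orbT.
have EG : E G <= n%:R * (e * t / 8) + (C + 1).
  rewrite /G expectD//; last exact: bmB.
  rewrite expectB// /U expectD ?expect_cst//; [|exact: bm_bsum_v|exact: bm_cst].
  rewrite expect_bsum_v//.
  have : n%:R * l <= E (v n) by have := lea n0; rewrite ler_pdivlMl.
  have : n%:R * a m <= n%:R * (l + e * t / 8) by rewrite ler_pM2l// ltW.
  lra.
set A1 := [set x | bsum (fun y => m%:R^-1 * v m y) n x < n%:R * (l - e / 2)].
set A2 := [set x | n%:R * (e / 2) < G x].
have mA1 : measurable A1 by have [+ _] := V1; exact.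
have mA2 : measurable A2 by exact: bm_lt.
apply: (@le_lt_trans _ _ (prob mu (A1 `|` A2))).
  apply: le_prob; [exact: mgt|exact: measurableU|move=> x /= vx].
  have [?|Sx] := ltP (bsum (fun y => m%:R^-1 * v m y) n x) (n%:R * (l - e / 2)).
    by left.
  right; rewrite /A2 /=.
  have C0 : 0 <= C by rewrite le_max lexx.
  have D0 : 0 <= D x by rewrite le_max lexx.
  by move: Sx; rewrite /G /U bsumZ; lra.
apply: le_lt_trans (probU _ mA1 mA2) _; rewrite [ltRHS]splitr ltr_leD//.
  by rewrite /A1; near: n; exact: V1t.
have := @markov _ _ _ mu G (n%:R * (e / 2)) A2 bG G0 mA2 (fun x => @ltW _ _ _ _).
move=> /le_trans/(_ EG) mk.
have et80 : 0 < n%:R * (e / 2) by rewrite mulr_gt0// divr_gt0.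
rewrite -(ler_pM2l et80) (le_trans mk)//.
suff : C + 1 <= n%:R * (e * t / 8) by lra.
by rewrite -ler_pdivrMr//; near: n; exact: nbhs_infty_ger.
Unshelve. all: by end_near. Qed.

End concentration.

(** * Words and information *)

Section words.
Context (k : nat).
Implicit Types (s t : seq 'I_k).

(** Words are sequences rather than functions on ['I_n], so that they can be cut and concatenated
    freely. *)
Fixpoint words n : seq (seq 'I_k) :=
  if n is n'.+1 then [seq c :: s | c <- enum 'I_k, s <- words n'] else [:: [::]].

Lemma mem_words n s : (s \in words n) = (size s == n).
Proof.
elim: n s => [|n ih] [|c s] //=.
  by apply/negbTE/negP => /allpairsP[[? ?] []].
rewrite eqSS -ih; apply/allpairsP/idP => [[[c' s'] /= [_ s'n [_ ->]]]//|sn].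
by exists (c, s); rewrite mem_enum.
Qed.

Lemma uniq_words n : uniq (words n).
Proof.
elim: n => [//|n ih]; apply: allpairs_uniq => //; first exact: enum_uniq.
by move=> [c s] [c' s'] _ _ [-> ->].
Qed.

Lemma size_words n : size (words n) = (k ^ n)%N.
Proof. by elim: n => [//|n ih]; rewrite size_allpairs ih -cardE card_ord expnS. Qed.

Lemma sum_words_cat (R : realType) p q (F : seq 'I_k -> R) :
  \sum_(s <- words (p + q)) F s =
  \sum_(s <- words p) \sum_(t <- words q) F (s ++ t).
Proof.
elim: p F => [|p ih] F; first by rewrite big_seq1.
rewrite !big_allpairs_dep; apply: eq_bigr => c _.
exact: (ih (fun s => F (c :: s))).
Qed.

Fixpoint hamming s t : nat :=
  match s, t with
  | a :: s', b :: t' => ((a != b) + hamming s' t')%N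
  | _, _ => 0%N
  end.

(** The sum factors over positions: at each one, the matching letter contributes 1 and the others at
    most [k%:R * b] together. *)
Lemma sum_hamming (R : realType) (b : R) s : 0 <= b ->
  \sum_(t <- words (size s)) b ^+ hamming s t <= (1 + k%:R * b) ^+ size s.
Proof.
move=> b0; elim: s => [|c s ih]; first by rewrite big_seq1.
rewrite big_allpairs_dep exprS.
under eq_bigr do under eq_bigr do rewrite /= exprD.
under eq_bigr do rewrite -mulr_sumr.
rewrite -mulr_suml ler_pM//; [apply: sumr_ge0 => a _..|]; rewrite ?exprn_ge0//.
apply: (@le_trans _ _ (\sum_(a <- enum 'I_k) ((c == a)%:R + b))).
  apply: ler_sum => a _; case: eqVneq => _; first by rewrite expr0 lerDl.
  by rewrite expr1 add0r.
rewrite big_split/= !big_enum/= (bigD1 c)//= eqxx big1 ?addr0.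
  by rewrite sumr_const card_ord mulr_natl.
by move=> a; rewrite eq_sym => /negbTE ->.
Qed.

(* Chernoff bound: give weight [b] to each mismatch. *)
Lemma hamming_ball_small (R : realType) (e : R) : 0 < e ->
  exists2 h : R, 0 < h & forall s,
    (count (fun t => (hamming s t)%:R <= (size s)%:R * h) (words (size s)))%:R
      <= expR ((size s)%:R * e).
Proof.
move=> e0; have k0 : (0 : R) <= k%:R by exact: ler0n.
have k10 : (0 : R) < 2 * (k%:R + 1) by lra.
(* This makes [k%:R * b <= e / 2], so the bound of [sum_hamming] costs at most half of the
   exponent. *)
pose b : R := Num.min 1 (e / (2 * (k%:R + 1))).
have b0 : 0 < b by rewrite lt_min ltr01 divr_gt0.
have b1 : b <= 1 by rewrite ge_min lexx.
have kb : k%:R * b <= e / 2.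
  rewrite (@le_trans _ _ ((k%:R + 1) * (e / (2 * (k%:R + 1)))))//.
    by rewrite ler_pM ?(ltW b0)// ?lerDl// ge_min lexx orbT.
  by rewrite le_eqVlt; apply/orP; left; apply/eqP; field; rewrite gt_eqF// ltr_wpDl//.
have L0 : 0 <= - ln b by rewrite oppr_ge0; exact: ln_le0.
have L1 : 0 < - ln b + 1 by rewrite ltr_wpDl//.
(* The factor [b ^- r] costs the other half; [+ 1] keeps the denominator positive when [b] is 1. *)
exists (e / 2 / (- ln b + 1)) => [|s]; first by rewrite !divr_gt0.
set h := e / 2 / _; pose r := Num.truncn ((size s)%:R * h).
have h0 : 0 <= (size s)%:R * h by rewrite mulr_ge0// ltW// !divr_gt0.
have rh : r%:R <= (size s)%:R * h by rewrite truncn_le.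
rewrite (eq_count (a2 := fun t => (hamming s t <= r)%N)); last first.
  by move=> t; rewrite /= truncn_ge_nat.
have : b ^+ r * (count (fun t => (hamming s t <= r)%N) (words (size s)))%:R
    <= (1 + k%:R * b) ^+ size s.
  apply: le_trans (sum_hamming s (ltW b0)).
  rewrite -sum1_count natr_sum mulr_sumr big_mkcond/=; apply: ler_sum => t _.
  case: ifPn => [st_r|_]; last by rewrite exprn_ge0 ?ltW.
  by rewrite mulr1 ler_wiXn2l// ltW.
rewrite -ler_pdivlMl ?exprn_gt0// => /le_trans; apply.
apply: (@le_trans _ _ (expR (r%:R * - ln b) * expR ((size s)%:R * (e / 2)))).
  apply: ler_pM; rewrite ?invr_ge0 ?exprn_ge0 ?addr_ge0 ?mulr_ge0 ?(ltW b0)//.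
    by rewrite expRM_natl expRN lnK ?posrE// exprVn.
  rewrite expRM_natl lerXn2r ?nnegrE ?addr_ge0 ?mulr_ge0 ?(ltW b0) ?expR_ge0//.
  by rewrite (le_trans (expR_ge1Dx _))// ler_expR.
rewrite -expRD ler_expR.
have : r%:R * - ln b <= (size s)%:R * (e / 2 / (- ln b + 1)) * (- ln b + 1).
  by rewrite ler_pM// lerDl.
by rewrite -mulrA divfK ?gt_eqF//; lra.
Qed.

End words.

(** * Information functions of a finite partition *)

Section information.
Context d (X : measurableType d) (R : realType) (mu : probability X R).
Context (T : X -> X) (mT : measurable_fun setT T).
Hypothesis invT : forall A : set X, measurable A -> mu (T @^-1` A) = mu A.
Context (k : nat) (lab : X -> 'I_k).
Hypothesis mlab : forall c, measurable (lab @^-1` [set c]).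
Implicit Types (s t : seq 'I_k).

Notation bm := (@bounded_measurable _ X R).
Notation E := (expect mu).
Notation P := (prob mu).
Notation bsum := (bsum T).

Fixpoint itin n x : seq 'I_k := if n is n'.+1 then lab x :: itin n' (T x) else [::].

Definition cell s : set X := [set x | itin (size s) x = s].

Lemma size_itin n x : size (itin n x) = n.
Proof. by elim: n x => //= n ih x; rewrite ih. Qed.

Lemma itin_words n x : itin n x \in words k n.
Proof. by rewrite mem_words size_itin. Qed.

Lemma itin_cat p q x : itin (p + q) x = itin p x ++ itin q (iter p T x).
Proof. by elim: p x => //= p ih x; rewrite ih -iterSr. Qed.

Lemma nth_itin c n x i : (i < n)%N -> nth c (itin n x) i = lab (iter i T x).
Proof. by elim: n x i => //= n ih x [|i]//= /ih ->; rewrite -iterSr. Qed.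

Lemma measurable_cell s : measurable (cell s).
Proof.
elim: s => [|c s ih].
  by rewrite (_ : cell [::] = setT)//; apply/seteqP; split.
rewrite (_ : cell (c :: s) = lab @^-1` [set c] `&` T @^-1` cell s).
  by apply: measurableI => //; rewrite -[X in measurable X]setTI; exact: mT.
apply/seteqP; split => x; rewrite /cell/=; first by case=> lx sx; split.
by case=> lx sx; rewrite lx sx.
Qed.

Definition pw s : R := P (cell s).

Lemma pw_ge0 s : 0 <= pw s. Proof. exact: prob_ge0. Qed.

Lemma pw_le1 s : pw s <= 1. Proof. by apply: prob_le1; exact: measurable_cell. Qed.

(** Exactly one cell of length [n] contains [x]. This reduces measurability and integration of
    functions of the itinerary to indicators of cells. *)
Lemma itin_expand n (F : seq 'I_k -> R) x :
  F (itin n x) = \sum_(s <- words k n) F s * \1_(cell s) x.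
Proof.
rewrite (bigD1_seq (itin n x)) ?itin_words ?uniq_words //=.
rewrite indicE mem_set ?mulr1; last by rewrite /cell /= size_itin.
rewrite big_seq_cond big1 ?addr0// => s /andP[]; rewrite mem_words => /eqP sn sx.
rewrite indicE memNset ?mulr0// => /=; rewrite /cell/= sn => e.
by rewrite e eqxx in sx.
Qed.

Lemma bm_itin n (F : seq 'I_k -> R) : bm (fun x => F (itin n x)).
Proof.
under eq_fun do rewrite itin_expand.
by apply: bm_sum => s; apply: bmZ; apply: bm_indic; exact: measurable_cell.
Qed.

Lemma expect_itin n (F : seq 'I_k -> R) :
  E (fun x => F (itin n x)) = \sum_(s <- words k n) F s * pw s.
Proof.
have b1 s : bm (\1_(cell s)) by apply: bm_indic; exact: measurable_cell.
under [X in expect _ X]eq_fun do rewrite itin_expand.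
rewrite expect_sum; last by move=> s; exact: bmZ.
apply: eq_bigr => s _; rewrite expectZ// expect_indic//; exact: measurable_cell.
Qed.

Lemma sum_pw n : \sum_(s <- words k n) pw s = 1.
Proof.
rewrite -[RHS](expect_cst mu) [RHS](expect_itin n (fun=> 1)).
by apply: eq_bigr => s _; rewrite mul1r.
Qed.

Lemma card_pw_ge n (c : R) : 0 < c ->
  (count (fun s => c <= pw s) (words k n))%:R <= c^-1.
Proof.
move=> c0; rewrite -(ler_pM2l c0) divff ?gt_eqF// -[leRHS](sum_pw n).
rewrite -sum1_count natr_sum mulr_sumr big_mkcond/=; apply: ler_sum => s _.
by case: ifPn => [|_]; rewrite ?mulr1 ?pw_ge0.
Qed.

Lemma pw_itin_le_prefix p q x : pw (itin (p + q) x) <= pw (itin p x).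
Proof.
apply: le_prob; try exact: measurable_cell.
move=> y; rewrite /cell/= !size_itin !itin_cat => /eqP.
by rewrite eqseq_cat ?size_itin// => /andP[/eqP].
Qed.

(** The cell lies in the preimage under [iter p T] of the suffix cell, which has the measure of that
    cell by invariance. *)
Lemma pw_itin_le_suffix p q x :
  pw (itin (p + q) x) <= pw (itin q (iter p T x)).
Proof.
have mq : measurable (cell (itin q (iter p T x))) by exact: measurable_cell.
have mTp : measurable (iter p T @^-1` cell (itin q (iter p T x))).
  by rewrite -[X in measurable X]setTI; exact: measurable_iter.
rewrite /pw -[leRHS](expect_indic mu mq) -[leRHS](expect_iter mT invT p); last first.
  exact: bm_indic.
rewrite (_ : (fun _ => _) = \1_(iter p T @^-1` cell (itin q (iter p T x))))//.
rewrite expect_indic//; apply: le_prob => //; first exact: measurable_cell.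
move=> y; rewrite /cell/= !size_itin !itin_cat => /eqP.
by rewrite eqseq_cat ?size_itin// => /andP[_ /eqP].
Qed.

(* Probability of the word under the measure for which the blocks are
   independent, with the initial and final incomplete blocks given weight [1]. *)
Fixpoint block_prob m q s : R :=
  if q is q'.+1 then pw (take m s) * block_prob m q' (drop m s) else 1.

Lemma block_prob_ge0 m q s : 0 <= block_prob m q s.
Proof. by elim: q s => //= q ih s; rewrite mulr_ge0// pw_ge0. Qed.

(** Each complete block sums to 1, and the [n %% m] final letters are free. *)
Lemma sum_block_prob m n : (0 < m)%N ->
  \sum_(s <- words k n) block_prob m (n %/ m) s = (k ^ (n %% m))%:R.
Proof.
move=> m0; elim/ltn_ind: n => n ih; have [nm|mn] := ltnP n m.
  rewrite divn_small// modn_small//=.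
  by rewrite big_const_seq count_predT iter_addr_0 size_words.
have -> : (n %/ m = ((n - m) %/ m).+1)%N.
  by rewrite -{1}(subnK mn) divnDr ?dvdnn// divnn m0 addn1.
rewrite -{1}(subnKC mn) sum_words_cat.
rewrite (eq_big_seq (fun s => pw s *
  \sum_(t <- words k (n - m)) block_prob m ((n - m) %/ m) t)); last first.
  move=> s; rewrite mem_words => /eqP sm; rewrite mulr_sumr.
  by apply: eq_bigr => t _; rewrite /= take_size_cat// drop_size_cat.
rewrite -mulr_suml sum_pw mul1r ih ?ltn_subrL ?m0 ?(leq_trans m0 mn)//.
by rewrite -{2}(subnK mn) modnDr.
Qed.

(** On null cells [ln 0 = 0] gives the value 0 instead of infinity; such points form a null set. *)
Definition info n x : R := - ln (pw (itin n x)).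

Lemma info_ge0 n x : 0 <= info n x.
Proof. by rewrite oppr_ge0; apply: ln_le0; exact: pw_le1. Qed.

Lemma bm_info n : bm (info n).
Proof. exact: (bm_itin n (fun s => - ln (pw s))). Qed.

Lemma expR_info n x : 0 < pw (itin n x) -> pw (itin n x) = expR (- info n x).
Proof. by move=> p0; rewrite opprK lnK. Qed.

(** Positive mass of the whole word forces positive mass of each of its blocks, so the default value
    of [ln] never enters. *)
Lemma block_prob_itin m n x : (0 < m)%N -> 0 < pw (itin n x) ->
  block_prob m (n %/ m) (itin n x) = expR (- block_sum T m (info m) n x).
Proof.
move=> m0; elim/ltn_ind: n x => n ih x px; have [nm|mn] := ltnP n m.
  by rewrite divn_small//= block_sum_lt// oppr0 expR0.
have -> : (n %/ m = ((n - m) %/ m).+1)%N.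
  by rewrite -{1}(subnK mn) divnDr ?dvdnn// divnn m0 addn1.
have pE := px; rewrite -(subnKC mn) in pE.
rewrite block_sum_ge//= -{1 3}(subnKC mn) itin_cat take_size_cat ?size_itin//.
rewrite drop_size_cat ?size_itin// opprD expRD -expR_info; last first.
  exact: lt_le_trans pE (pw_itin_le_prefix _ _ _).
rewrite ih ?ltn_subrL ?m0 ?(leq_trans m0 mn)//.
exact: lt_le_trans pE (pw_itin_le_suffix _ _ _).
Qed.

(* Gibbs' inequality for the block measure, in the form [log^+ t <= t]. *)
Lemma info_block_sum m j n : (0 < m)%N -> (j < m)%N -> (m <= n)%N ->
  E (fun x => Num.max 0 (info n x -
    (block_sum T m (info m) (n - j) (iter j T x) + ln (k ^ (2 * m))%:R))) <= 1.
Proof.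
(* [K] bounds the total weight of the block measure: at most [m] letters are free before the blocks
   and at most [m] after them. *)
move=> m0 jm mn; set K : R := (k ^ (2 * m))%:R.
have jn : (j <= n)%N by exact: leq_trans (ltnW jm) mn.
pose c0 := lab point.
have k0 : (0 < k)%N by case: (k) c0 => // -[].
have K0 : 0 < K by rewrite ltr0n expn_gt0 k0.
have K1 : 1 <= K by rewrite ler1n expn_gt0 k0.
(* The likelihood ratio of the normalized block measure to [mu]; on null words the inverse of 0
   makes it 0. *)
pose G s : R := block_prob m ((n - j) %/ m) (drop j s) * (pw s * K)^-1.
have G0 s : 0 <= G s.
  by rewrite mulr_ge0 ?block_prob_ge0// invr_ge0 mulr_ge0 ?pw_ge0// ltW.
apply: (@le_trans _ _ (E (fun x => G (itin n x)))).
  apply: le_expect; [|exact: bm_itin|move=> x].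
    apply: bm_max; [exact: bm_cst|apply: bmB; first exact: bm_info].
    apply: bmD; [|exact: bm_cst].
    apply: (@bm_iter _ _ _ _ mT (block_sum T m (info m) (n - j)) j).
    by apply: bm_sum => i; apply: bm_iter => //; exact: bm_info.
  have B0 y : 0 <= block_sum T m (info m) (n - j) y.
    by apply: sumr_ge0 => i _; exact: info_ge0.
  rewrite ge_max G0/=; have := pw_ge0 (itin n x); rewrite le_eqVlt.
  move=> /predU1P[p0|p0].
    rewrite {1}/info -p0 ln0// oppr0 sub0r (le_trans _ (G0 _))// oppr_le0.
    by rewrite addr_ge0// ln_ge0.
  have pE := p0; rewrite -{1}(subnKC jn) in pE.
  have -> : G (itin n x) = expR (info n x -
      (block_sum T m (info m) (n - j) (iter j T x) + ln K)).
    rewrite /G -{2}(subnKC jn) itin_cat drop_size_cat ?size_itin//.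
    rewrite block_prob_itin//; last first.
      exact: lt_le_trans pE (pw_itin_le_suffix _ _ _).
    rewrite opprD addrA [X in X - ln K]addrC !expRD [expR (- ln K)]expRN lnK ?posrE//.
    rewrite invfM mulrA; congr (_ * _ / _).
    by rewrite expR_info// -expRN opprK.
  by rewrite (le_trans _ (expR_ge1Dx _))// lerDr.
rewrite expect_itin; apply: (@le_trans _ _ (\sum_(s <- words k n)
    block_prob m ((n - j) %/ m) (drop j s) / K)).
  apply: ler_sum => s _; rewrite /G -mulrA ler_wpM2l ?block_prob_ge0//.
  rewrite invfM mulrC mulrA ler_piMl ?invr_ge0 ?(ltW K0)//.
  have [->|p0] := eqVneq (pw s) 0; first by rewrite mul0r.
  by rewrite divff.
rewrite -mulr_suml ler_pdivrMr// mul1r -{1}(subnKC jn) sum_words_cat.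
rewrite (eq_big_seq (fun=> (k ^ ((n - j) %% m))%:R)); last first.
  move=> s; rewrite mem_words => /eqP sj; rewrite -sum_block_prob//.
  by apply: eq_bigr => t _; rewrite drop_size_cat.
rewrite big_const_seq count_predT iter_addr_0 size_words -mulrnA.
rewrite ler_nat -expnD leq_pexp2l// mul2n -addnn leq_add//.
  by apply: ltnW; exact: ltn_pmod.
exact: ltnW.
Qed.

(** Average [info_block_sum] over the offsets [j < m]: the positive part of an average is at most
    the average of the positive parts, and the final terms missing from the ergodic sum are
    nonnegative. *)
Lemma info_almost_subadditive m : (0 < m)%N -> exists C, forall n, (m <= n)%N ->
  E (fun x => Num.max 0 (info n x - (m%:R^-1 * bsum (info m) n x + C))) <= 1.
Proof.
move=> m0; exists (ln (k ^ (2 * m))%:R) => n mn; set C := ln _.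
pose D j x := Num.max 0 (info n x -
  (block_sum T m (info m) (n - j) (iter j T x) + C)).
have bD (j : 'I_m) : bm (D j).
  apply: bm_max; [exact: bm_cst|apply: bmB; first exact: bm_info].
  apply: bmD; [|exact: bm_cst].
  apply: (@bm_iter _ _ _ _ mT (block_sum T m (info m) (n - j)) j).
  by apply: bm_sum => i; apply: bm_iter => //; exact: bm_info.
have m0R : (0 : R) < m%:R by rewrite ltr0n.
apply: (@le_trans _ _ (E (fun x => m%:R^-1 * \sum_(j < m) D j x))); last first.
  rewrite expectZ; last exact: bm_sum.
  rewrite expect_sum// ler_pdivrMl// mulr1.
  apply: (@le_trans _ _ (\sum_(j < m) 1)); last by rewrite sumr_const card_ord.
  by apply: ler_sum => j _; exact: info_block_sum.
apply: le_expect => [||x].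
- apply: bm_max; [exact: bm_cst|apply: bmB; first exact: bm_info].
  by apply: bmD; [apply: bmZ; apply: bm_bsum => //; exact: bm_info|exact: bm_cst].
- by apply: bmZ; exact: bm_sum.
rewrite ge_max; apply/andP; split.
  rewrite mulr_ge0 ?invr_ge0//; apply: sumr_ge0 => j _.
  by rewrite le_max lexx.
rewrite -(ler_pM2l m0R) mulrA divff ?gt_eqF// mul1r.
apply: (@le_trans _ _ (\sum_(j < m) (info n x -
  (block_sum T m (info m) (n - j) (iter j T x) + C)))); last first.
  by apply: ler_sum => j _; rewrite le_max lexx orbT.
rewrite sumrB big_split/= sum_block_sum// !sumr_const card_ord.
suff : bsum (info m) (n.+1 - m) x <= bsum (info m) n x.
  by rewrite mulrBr mulrDr mulrA divff ?gt_eqF// mul1r !mulr_natl; lra.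
have pn : (n.+1 - m <= n)%N by rewrite leq_subLR -add1n leq_add2r.
rewrite -{2}(subnKC pn) bsum_cat lerDl; apply: sumr_ge0 => i _.
exact: info_ge0.
Qed.

End information.

(** * Borel sets of a metric space *)

Section metric_borel.
Context (R : realType) (X : pmetricType R).
Implicit Types (A : set (borel X)) (psi : X -> R) (T : X -> X).

Lemma borel_open A : open (A : set X) -> measurable A.
Proof. exact: sub_sigma_algebra. Qed.

Lemma open_mdist_lt (x : X) (e : R) : open [set y | mdist x y < e].
Proof.
rewrite openE => y /= xy; apply/nbhs_ballP; exists (e - mdist x y) => /=.
  by rewrite subr_gt0.
rewrite ballEmdist => z /= yz; apply: le_lt_trans (metric_triangle x y z) _.
by rewrite -ltrBrDl.
Qed.

Lemma continuous_measurable psi : continuous psi ->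
  measurable_fun [set: borel X] psi.
Proof.
move=> cpsi; apply: (measurability (@RGenOInfty.G R)).
  exact: RGenOInfty.measurableE.
move=> _ [_ [x ->] <-]; rewrite setTI; apply: borel_open.
by move/continuousP : cpsi; apply; exact: interval_open.
Qed.

Lemma continuous_measurable_self T : continuous T ->
  measurable_fun [set: borel X] (T : borel X -> borel X).
Proof.
move=> cT; apply: (@measurability _ _ (borel X) (borel X) setT T (@open X)) => //.
move=> _ [A oA <-]; rewrite setTI.
by apply: borel_open; move/continuousP : cT; exact.
Qed.

Lemma continuous_iter T n : continuous T -> continuous (iter n T).
Proof.
move=> cT; elim: n => [x|n ih x]; first exact: cvg_id.
exact: (continuous_comp (ih x) (cT _)).
Qed.

Hypothesis compactX : compact [set: X].

Lemma compact_continuous_bounded psi : continuous psi ->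
  exists C, forall x, `|psi x| <= C.
Proof.
move=> cpsi; have /compact_near_coveringP cov := compactX.
have [x _|N _ /(_ N (leqnn N)) nP] :=
    cov nat \oo (fun n x => `|psi x| <= n%:R) _; last first.
  by exists N%:R => x; exact: nP.
near=> y n; apply: (@le_trans _ _ (`|psi x| + 1)).
  rewrite -lerBlDl (le_trans (lerB_dist _ _))// distrC /=.
  by near: y; apply: cvgr_dist_le; [exact: cpsi|exact: ltr01].
by rewrite /=; near: n; exact: nbhs_infty_ger.
Unshelve. all: by end_near. Qed.

Lemma compact_continuous_unif psi e : continuous psi -> 0 < e ->
  exists2 r, 0 < r & forall x y, mdist x y < r -> `|psi x - psi y| < e.
Proof.
move=> cpsi e0; have /compact_near_coveringP cov := compactX.
have e20 : 0 < e / 2 by rewrite divr_gt0.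
have [x _|r /= r0 rP] := cov R 0^'+
    (fun r x => forall y, mdist x y < r -> `|psi x - psi y| < e) _; last first.
  exists (r / 2) => [|x y xy]; first by rewrite divr_gt0.
  apply: (rP (r / 2)) xy => //=; last by rewrite divr_gt0.
  by rewrite sub0r normrN gtr0_norm ?divr_gt0// ltr_pdivrMr// ltr_pMr// ltr1n.
have : \forall y \near x, `|psi x - psi y| < e / 2.
  by apply: cvgr_dist_lt => //; exact: cpsi.
move=> /nbhs_ballP[r /= r0]; rewrite ballEmdist => xr.
have r20 : 0 < r / 2 by rewrite divr_gt0.
near=> y t => /= z yz.
have xy : mdist x y < r / 2.
  by near: y; apply/nbhs_ballP; exists (r / 2) => //= z'; rewrite ballEmdist.
have tr : t < r / 2 by near: t; exact: nbhs_right_lt.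
rewrite (le_lt_trans (ler_distD (psi x) _ _))// (splitr e) ltrD//.
  by rewrite distrC xr//= (lt_trans xy)// ltr_pdivrMr// ltr_pMr// ltr1n.
rewrite xr//= (le_lt_trans (metric_triangle x y z))// (splitr r) ltrD//.
exact: lt_trans yz tr.
Unshelve. all: by end_near. Qed.

Lemma continuous_bm psi : continuous psi -> @bounded_measurable _ (borel X) R psi.
Proof.
by move=> cpsi; split; [exact: continuous_measurable|exact: compact_continuous_bounded].
Qed.

(** Every label has to occur because the cells of a [measurable_partition] are nonempty. *)
Lemma exists_small_labelling e : 0 < e ->
  exists k (lab : borel X -> 'I_k),
    [/\ forall c, measurable (lab @^-1` [set c]),
        forall c, exists x, lab x = c
      & forall x y, lab x = lab y -> mdist x y < e].
Proof.
move=> e0.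
have e20 : 0 < e / 2 by rewrite divr_gt0.
pose small k := exists lab : borel X -> 'I_k,
  (forall c, measurable (lab @^-1` [set c])) /\
  (forall x y, lab x = lab y -> mdist x y < e).
have ex_small : exists k, `[< small k >].
  have := compactX; rewrite compact_cover.
  move=> /(_ X setT (fun c => [set y | mdist c y < e / 2])).
  case=> [c _|x _|D _ coverD]; first exact: open_mdist_lt.
    by exists x => //=; rewrite mdistxx.
  (* A point is labelled by the first ball of a finite cover that contains it. *)
  pose pr (x : borel X) c := mdist c x < e / 2.
  have mfind (s : seq X) i : measurable [set x : borel X | find (pr x) s = i].
    elim: s i => [|c s ih] i /=.
      have [->|i0] := eqVneq i 0%N.
        by rewrite (_ : [set _ | _] = setT)//; apply/seteqP; split.
      rewrite (_ : [set _ | _] = set0)//; apply/seteqP; split => // x /= e'.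
      by rewrite -e' in i0.
    have mc : measurable ([set x | mdist c x < e / 2] : set (borel X)).
      by apply: borel_open; exact: open_mdist_lt.
    case: i => [|i].
      rewrite (_ : [set _ | _] = [set x | mdist c x < e / 2])//.
      by apply/seteqP; split => x /=; rewrite /pr; case: ifP.
    rewrite (_ : [set _ | _] = ~` [set x | mdist c x < e / 2] `&`
        [set x | find (pr x) s = i]).
      by apply: measurableI; [exact: measurableC|exact: ih].
    apply/seteqP; split => x /=; rewrite /pr; case: ifP => cx.
    - by [].
    - by case.
    - by case.
    - by case=> _ ->.
  pose s : seq X := finmap.enum_fset D; exists (size s).+1; apply/asboolP.
  exists (fun x => inord (find (pr x) s)).
  have findlt x : (find (pr x) s < size s)%N.
    have [c /= cD xc] := coverD x I.
    by rewrite -has_find; apply/hasP; exists c.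
  split=> [c|x y].
    rewrite (_ : _ @^-1` _ = [set x | find (pr x) s = c])//.
    apply/seteqP; split => x /=.
      by move=> <-; rewrite inordK// ltnS ltnW.
    by move=> fc; apply: val_inj; rewrite /= inordK ?fc.
  move=> /(congr1 val)/=; rewrite !inordK ?ltnS 1?ltnW// => xy.
  have hx : has (pr x) s by rewrite has_find.
  have hy : has (pr y) s by rewrite has_find.
  have := nth_find point hx; have := nth_find point hy; rewrite /pr xy => cy cx.
  rewrite (le_lt_trans (metric_triangle _ (nth point s (find (pr y) s)) _))//.
  by rewrite (splitr e) ltrD// metric_sym.
case: (ex_minnP ex_small) => k /asboolP[lab [mlab dlab]] min_k.
exists k, lab; split => // c; apply: contrapT => nc.
have labc x : c != lab x by apply/eqP => cx; apply: nc; exists x.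
case: k lab mlab dlab min_k c nc labc => [|k] lab mlab dlab min_k c nc labc.
  by case: c nc labc.
suff : `[< small k >] by move=> /min_k; rewrite ltnn.
have labE x : {c' | lab x = lift c c'}.
  by have /unlift_some[c' -> _] := labc x; exists c'.
apply/asboolP; exists (fun x => sval (labE x)); split => [c'|x y xy].
  rewrite (_ : _ @^-1` _ = lab @^-1` [set lift c c'])//.
  apply/seteqP; split => x /=; case: (labE x) => c1 /= lx.
    by move=> <-.
  by rewrite lx => /lift_inj.
apply: dlab; move: xy; case: (labE x) => c1 lx; case: (labE y) => c2 ly /= c12.
by rewrite lx ly c12.
Qed.

(** * Uniform local constancy of Borel sets off a set of small measure *)

Section regular.
Context (mu : probability (borel X) R).

(** The one-sided implication suffices: exchanging [x] and [y] gives the converse, hence the same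
    property for the complement. *)
Definition nearly_uniform A : Prop := forall e, 0 < e ->
  exists V : set (borel X), [/\ measurable V, prob mu V < e &
    exists2 r, 0 < r & forall x y : X, ~ V x -> ~ V y -> mdist x y < r ->
      A x -> A y].

(** Take for [V] the points of [A] at distance less than [n.+1%:R^-1] from some point outside [A];
    these sets decrease to the empty set because [A] is open. *)
Lemma nearly_uniform_open A : open (A : set X) -> nearly_uniform A.
Proof.
move=> oA e e0.
pose F n : set (borel X) := [set x | exists2 z, ~ A z & mdist z x < n.+1%:R^-1].
have mF n : measurable (F n).
  apply: borel_open; rewrite (_ : F n =
      \bigcup_(z in ~` A) [set x | mdist z x < n.+1%:R^-1]).
    by apply: bigcup_open => z _; exact: open_mdist_lt.
  by apply/seteqP; split => x [z Az zx]; exists z.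
have mA : measurable A by exact: borel_open.
have capF : \bigcap_n (A `&` F n) = set0.
  apply/seteqP; split => // x AF; have [Ax _] := AF 0%N I.
  move: oA; rewrite openE => /(_ x Ax)/nbhs_ballP[r /= r0]; rewrite ballEmdist => rA.
  have [n nr] : exists n, n.+1%:R^-1 < r.
    exists (Num.truncn r^-1); rewrite -[ltRHS]invrK ltf_pV2 ?posrE ?invr_gt0//.
    exact: truncnS_gt.
  have [_ [z Az zx]] := AF n I; apply: Az; apply: rA => /=.
  by rewrite metric_sym (lt_trans zx).
have mAF n : measurable (A `&` F n) by exact: measurableI.
have : prob mu (A `&` F n) @[n --> \oo] --> (0 : R).
  apply: (@fine_cvg _ _ _ _ (fun n => mu (A `&` F n))).
  rewrite -[0%:E](measure0 mu) -capF; apply: nonincreasing_cvg_mu => //.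
  - by rewrite (le_lt_trans (probability_le1 mu _))// ltry.
  - by rewrite capF.
  - move=> m n mn; apply/subsetPset => x [Ax [z Az zx]]; split => //; exists z => //.
    by rewrite (lt_le_trans zx)// lef_pV2 ?posrE// ler_nat ltnS.
move=> /cvgr_dist_lt/(_ e e0)[n _ /(_ n (leqnn n))].
rewrite /= sub0r normrN ger0_norm ?prob_ge0// => Pn.
exists (A `&` F n); split => //; exists n.+1%:R^-1 => // x y Vx _ xy Ax.
apply: contrapT => Ay; apply: Vx; split => //; exists y => //.
by rewrite metric_sym.
Qed.

(** The sets with both properties form a sigma-algebra containing the open sets. For a countable
    union, a finite part is treated by induction and the rest, of small measure, is added to [V]. *)
Lemma measurable_nearly_uniform A : measurable A ->
  nearly_uniform A /\ nearly_uniform (~` A).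
Proof.
pose G : set (set (borel X)) :=
  [set A | measurable A /\ nearly_uniform A /\ nearly_uniform (~` A)].
have compl B : nearly_uniform B -> nearly_uniform (~` B).
  move=> uA e e0; have [V [mV PV [r r0 Vr]]] := uA e e0.
  exists V; split => //; exists r => // x y Vx Vy xy nAx Ay; apply: nAx.
  by apply: Vr Ay => //; rewrite metric_sym.
suff GA : <<s @open X >> `<=` G by move=> /GA[].
apply: smallest_sub; last first.
  move=> B oB; split; first exact: borel_open.
  by have := nearly_uniform_open oB; split => //; exact: compl.
split=> [|B [mB [uB ucB]]|B0 GB0].
- split; first exact: measurable0; rewrite setC0; split => e e0; exists set0.
    by split; [exact: measurable0|rewrite prob0|exists 1].
  by split; [exact: measurable0|rewrite prob0|exists 1].
- rewrite setTD; split; first exact: measurableC.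
  by rewrite setCK.
pose B : nat -> set (borel X) := B0; have GB n : G (B n) := GB0 n.
change (G (\bigcup_n B n)).
have mB n : measurable (B n) by have [] := GB n.
have mU : measurable (\bigcup_n B n) by exact: bigcup_measurable.
split=> //; suff : nearly_uniform (\bigcup_n B n) by split => //; exact: compl.
move=> e e0; have e20 : 0 < e / 2 by rewrite divr_gt0.
pose S n : set (borel X) := \bigcup_(i < n) B i.
have mS n : measurable (S n) by apply: bigcup_measurable => i _.
have uS n : nearly_uniform (S n).
  elim: n => [|N ih] t t0.
    exists set0; rewrite prob0; split => //; exists 1 => // x y _ _ _.
    by case=> i.
  have t20 : 0 < t / 2 by rewrite divr_gt0.
  have [V [mV PV [r r0 Vr]]] := ih _ t20.
  have [_ [/(_ _ t20)[V' [mV' PV' [r' r'0 Vr']]] _]] := GB N.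
  exists (V `|` V'); split; first exact: measurableU.
    by rewrite (le_lt_trans (probU _ mV mV'))// (splitr t) ltrD.
  exists (Num.min r r') => [|x y /not_orP[Vx V'x] /not_orP[Vy V'y]].
    by rewrite lt_min r0.
  rewrite lt_min => /andP[xyr xyr'] [i /=]; rewrite ltnS leq_eqVlt.
  case/predU1P => [-> BN|iN Bi]; first by exists N => //=; exact: (Vr' x).
  have [j /= jN Bj] : S N y by apply: (Vr x) => //; exists i.
  by exists j => //=; exact: ltnW.
have capS : \bigcap_n ((\bigcup_i B i) `\` S n) = set0.
  apply/seteqP; split => // x US; have [[i _ Bi] _] := US 0%N I.
  by have [_] := US i.+1 I; apply; exists i => //=.
have mUS n : measurable ((\bigcup_i B i) `\` S n) by exact: measurableD.
have : prob mu ((\bigcup_i B i) `\` S n) @[n --> \oo] --> (0 : R).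
  apply: (@fine_cvg _ _ _ _ (fun n => mu ((\bigcup_i B i) `\` S n))).
  rewrite -[0%:E](measure0 mu) -capS; apply: nonincreasing_cvg_mu => //.
  - by rewrite (le_lt_trans (probability_le1 mu _))// ltry.
  - by rewrite capS.
  - move=> m n mn; apply/subsetPset => x [Ux Sx]; split => // -[i /= im Bi].
    by apply: Sx; exists i => //=; exact: leq_trans mn.
move=> /cvgr_dist_lt/(_ _ e20)[N _ /(_ N (leqnn N))].
rewrite /= sub0r normrN ger0_norm ?prob_ge0// => PN.
have [V [mV PV [r r0 Vr]]] := uS N _ e20.
exists (V `|` ((\bigcup_i B i) `\` S N)); split; first exact: measurableU.
  by rewrite (le_lt_trans (probU _ mV (mUS N)))// (splitr e) ltrD.
exists r => // x y /not_orP[Vx USx] /not_orP[Vy _] xy Ux.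
have Sx : S N x by apply: contrapT => nSx; apply: USx.
by have [i _ Bi] := Vr x y Vx Vy xy Sx; exists i.
Qed.

Lemma labelling_nearly_uniform k (lab : borel X -> 'I_k) e :
  (forall c, measurable (lab @^-1` [set c])) -> 0 < e ->
  exists V : set (borel X), [/\ measurable V, prob mu V < e &
    exists2 r, 0 < r & forall x y : X, ~ V x -> ~ V y -> mdist x y < r ->
      lab x = lab y].
Proof.
move=> mlab e0.
suff [V [mV PV [r r0 Vr]]] : exists V : set (borel X),
    [/\ measurable V, prob mu V < e &
    exists2 r, 0 < r & forall x y : X, ~ V x -> ~ V y -> mdist x y < r ->
      forall c, c \in enum 'I_k -> lab x = c -> lab y = c].
  exists V; split => //; exists r => // x y Vx Vy xy.
  by rewrite (Vr x y Vx Vy xy (lab x)) ?mem_enum.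
elim: (enum 'I_k) e e0 => [|c s ih] e e0.
  by exists set0; rewrite prob0; split => //; exists 1.
have e20 : 0 < e / 2 by rewrite divr_gt0.
have [V [mV PV [r r0 Vr]]] := ih _ e20.
have [/(_ _ e20)[V' [mV' PV' [r' r'0 Vr']]] _] := measurable_nearly_uniform (mlab c).
exists (V `|` V'); split; first exact: measurableU.
  by rewrite (le_lt_trans (probU _ mV mV'))// (splitr e) ltrD.
exists (Num.min r r') => [|x y /not_orP[Vx V'x] /not_orP[Vy V'y]].
  by rewrite lt_min r0.
rewrite lt_min => /andP[xyr xyr'] c'; rewrite inE => /predU1P[->|c's].
  exact: (Vr' x y).
exact: (Vr x y).
Qed.

End regular.

End metric_borel.

(** * Entropy and pressure potentials *)

Section infimum.
Context (R : realType).

Lemma exists_inf_adherent (a : nat -> R) (b : R) :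
  (forall n, (0 < n)%N -> b <= a n) ->
  exists2 l, (forall n, (0 < n)%N -> l <= a n) &
    forall e, 0 < e -> exists2 m, (0 < m)%N & a m < l + e.
Proof.
move=> ba; pose S := [set a n | n in [set n | (0 < n)%N]].
have lbS : has_lbound S by exists b => _ [n /= n0 <-]; exact: ba.
have infS : has_inf S by split => //; exists (a 1%N), 1%N.
exists (inf S) => [n n0|e e0]; first by apply: ge_inf => //; exists n.
by have [_ [m /= m0 <-] am] := inf_adherent e0 infS; exists m.
Qed.

Lemma limn_esup_lt_near (u : nat -> \bar R) (c : \bar R) :
  (limn_esup u < c)%E -> \forall n \near \oo, (u n < c)%E.
Proof.
rewrite /limn_esup /limf_esup => /ereal_inf_lt[_ [A Aoo <-] supc].
apply: filterS Aoo => n An; apply: le_lt_trans supc.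
by apply: ereal_sup_ubound; exists n.
Qed.

End infimum.

Section entropy.
Context (R : realType) (X : pmetricType R) (T : borel X -> borel X).
Context (mu : probability (borel X) R).
Hypothesis mT : measurable_fun [set: borel X] T.
Hypothesis invmu : invariant_measure T mu.

Notation cells lab := (fun i => lab @^-1` [set i]).

Lemma partition_labelling k (A : 'I_k -> set (borel X)) :
  measurable_partition A -> exists lab : borel X -> 'I_k,
    (forall c, measurable (lab @^-1` [set c])) /\ A = cells lab.
Proof.
move=> [mA [covA trivA _]].
have xA x : exists i, A i x.
  have [i _ Aix] : cover setT A x by rewrite covA.
  by exists i.
have [lab labA] := choice xA; exists lab.
suff AE : A = cells lab by split => // c; have := mA c; rewrite AE.
apply/funext => i; apply/seteqP; split => x /= => [Aix|<- //].
by apply: trivA => //; exists x.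
Qed.

Lemma labelling_partition k (lab : borel X -> 'I_k) :
  (forall c, measurable (lab @^-1` [set c])) -> (forall c, exists x, lab x = c) ->
  measurable_partition (cells lab).
Proof.
move=> mlab slab; split => //; split.
- by apply/seteqP; split => // x _; exists (lab x).
- by move=> i j _ _ [x [/= <- <-]].
- by move=> i _; have [x <-] := slab i; exists x.
Qed.

Section labelling.
Context (k : nat) (lab : borel X -> 'I_k).
Hypothesis mlab : forall c, measurable (lab @^-1` [set c]).

(** Both sides sum [- p ln p] over the cells, indexed by finite functions on the left and by words
    on the right; [w2s] is the bijection. *)
Lemma join_entropyE n :
  join_entropy T mu (cells lab) n = expect mu (info mu T lab n).
Proof.
rewrite [RHS](expect_itin mu mT mlab n (fun s => - ln (pw mu T lab s))).
pose w2s (w : {ffun 'I_n -> 'I_k}) : seq 'I_k := [seq w i | i <- enum 'I_n].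
have w2sn (w : {ffun 'I_n -> 'I_k}) (i : 'I_n) c : nth c (w2s w) i = w i.
  by rewrite (nth_map i) ?size_enum_ord// nth_ord_enum.
have -> : \sum_(s <- words k n) - ln (pw mu T lab s) * pw mu T lab s =
    \sum_(s <- [seq w2s w | w <- index_enum {ffun 'I_n -> 'I_k}])
      - ln (pw mu T lab s) * pw mu T lab s.
  apply: perm_big; apply: uniq_perm; first exact: uniq_words.
    rewrite map_inj_uniq ?index_enum_uniq// => w w' ww'.
    by apply/ffunP => i; rewrite -(w2sn w i (w i)) ww' w2sn.
  move=> s; rewrite mem_words; apply/eqP/mapP => [sn|[w _ ->]]; last first.
    by rewrite size_map size_enum_ord.
  have c : 'I_k := lab point.
  exists [ffun i : 'I_n => nth c s i]; first exact: mem_index_enum.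
  apply: (@eq_from_nth _ c) => [|i].
    by rewrite size_map size_enum_ord.
  by rewrite sn => i_n; rewrite (w2sn _ (Ordinal i_n)) ffunE.
rewrite big_map; apply: eq_bigr => w _.
suff -> : join_cell T (cells lab) w = cell T lab (w2s w).
  by rewrite /= /pw /prob mulNr mulrC.
have sw : size (w2s w) = n by rewrite size_map size_enum_ord.
apply/seteqP; split => x; rewrite /join_cell /cell /= sw => h.
  apply: (@eq_from_nth _ (lab x)); rewrite size_itin// => i i_n.
  by rewrite nth_itin// (w2sn _ (Ordinal i_n)) -(h (Ordinal i_n)).
move=> i; rewrite -(w2sn w i (lab x)) -h nth_itin//.
Qed.

(** The normalized means of [info] are nonnegative and almost subadditive, so their limit is their
    infimum, a real number. *)
Lemma partition_entropy_inf : exists2 h : R,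
  partition_entropy T mu (cells lab) = h%:E &
  (forall n, (0 < n)%N -> h <= n%:R^-1 * expect mu (info mu T lab n)) /\
  forall e, 0 < e -> exists2 m, (0 < m)%N &
    m%:R^-1 * expect mu (info mu T lab m) < h + e.
Proof.
pose a n := n%:R^-1 * expect mu (info mu T lab n).
have a0 n : (0 < n)%N -> 0 <= a n.
  move=> _; rewrite mulr_ge0 ?invr_ge0//; apply: Rintegral_ge0 => x _.
  exact: info_ge0.
have [h ha infh] := exists_inf_adherent a0; exists h => //.
have cvgh : a n @[n --> \oo] --> h.
  apply: (mean_cvg_inf mT invmu) ha infh => [n _|m m0]; first exact: bm_info.
  exact: info_almost_subadditive.
rewrite /partition_entropy; apply/cvg_lim => //.
under eq_fun do rewrite join_entropyE.
by apply: cvg_EFin; [exact: nearW|exact: cvgh].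
Qed.

End labelling.
End entropy.

(** * Growth of an asymptotically subadditive potential *)

Section potential.
Context (R : realType) (X : pmetricType R) (T : X -> X).
Context (mu : probability (borel X) R) (f : nat -> X -> R).
Hypothesis compactX : compact [set: X].
Hypothesis contT : continuous T.
Hypothesis asf : asymp_subadditive_potential T f.
Hypothesis ergmu : ergodic_measure T mu.

Notation E := (expect mu).

Let mT : measurable_fun [set: borel X] (T : borel X -> borel X).
Proof. exact: continuous_measurable_self. Qed.

Let contf n : (0 < n)%N -> continuous (f n). Proof. by case: asf => + _; apply. Qed.

Let bmf n : (0 < n)%N -> @bounded_measurable _ (borel X) R (f n).
Proof. by move=> n0; apply: continuous_bm => //; exact: contf. Qed.

Lemma le_supnorm (u : X -> R) x : continuous u -> `|u x| <= supnorm u.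
Proof.
move=> cu; have [C uC] := compact_continuous_bounded compactX cu.
by apply: ub_le_sup; [exists C => _ [y _ <-]|exists x].
Qed.

Lemma subadditive_approximation e : 0 < e -> exists2 phi,
  subadditive_potential T phi &
  \forall n \near \oo, forall x, `|f n x - phi n x| <= n%:R * e.
Proof.
move=> e0; pose k := (Num.truncn e^-1).+1.
have ke : k%:R^-1 < e.
  by rewrite -[ltRHS]invrK ltf_pV2 ?posrE ?invr_gt0//; exact: truncnS_gt.
have [phi [subphi lephi]] := asf.2 k isT; exists phi => //.
have lt_e : \forall n \near \oo, ((n%:R^-1 * supnorm (f n \- phi n))%:E < e%:E)%E.
  by apply: limn_esup_lt_near; apply: le_lt_trans lephi _; rewrite lte_fin.
near=> n => x; have n0 : (0 < n)%N by near: n; exact: nbhs_infty_gt.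
have : ((n%:R^-1 * supnorm (f n \- phi n))%:E < e%:E)%E.
  by near: n; exact: lt_e.
rewrite lte_fin ltr_pdivrMl ?ltr0n// => /ltW; apply: le_trans.
apply: (@le_supnorm (f n \- phi n)) => y; apply: continuousB; first exact: contf.
by case: subphi => + _; apply.
Unshelve. all: by end_near. Qed.

Section subadditive.
Context (phi : nat -> X -> R).
Hypothesis subphi : subadditive_potential T phi.

Lemma subadditive_bm n : (0 < n)%N -> @bounded_measurable _ (borel X) R (phi n).
Proof. by move=> n0; apply: continuous_bm => //; case: subphi => + _; apply. Qed.

Lemma subadditive_bound m : (0 < m)%N -> exists C, forall n x, (0 < n)%N ->
  phi n x <= m%:R^-1 * bsum T (phi m) n x + C.
Proof.
move=> m0; have [K phiK] : exists K, forall i y, (0 < i <= m)%N -> `|phi i y| <= K.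
  elim: m {m0} => [|m [K phiK]]; first by exists 0 => -[|i] y /andP[].
  have [C phiC] := compact_continuous_bounded compactX (subphi.1 m.+1 isT).
  exists (Num.max K C) => i y /andP[i0]; rewrite leq_eqVlt ltnS le_max.
  by case/predU1P => [->|im]; rewrite ?phiC ?orbT// phiK// i0.
exists (4 * K) => n x n0; apply: subadditive_le_bsum => //.
by move=> p q y p0 q0; exact: subphi.2.
Qed.

Lemma subadditive_mean_bound m : (0 < m)%N -> exists C, forall n, (m <= n)%N ->
  E (fun x => Num.max 0 (phi n x - (m%:R^-1 * bsum T (phi m) n x + C))) <= 1.
Proof.
move=> m0; have [C phiC] := subadditive_bound m0; exists C => n mn.
rewrite (_ : (fun x => _) = fun=> 0) ?expect_cst//; apply/funext => x.
by apply/max_idPl; rewrite subr_le0 phiC// (leq_trans m0).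
Qed.

End subadditive.

Let b n := n%:R^-1 * E (f n).

Let FstarE : Fstar mu f = limn (fun n => (b n)%:E).
Proof.
rewrite /Fstar; congr (limn _); apply/funext => -[|n].
  (* Nothing is known about [f 0], but the inverse of 0 is 0 and kills both sides. *)
  by rewrite /b invr0 mul0e mul0r.
rewrite /b EFinM; congr (_ * _)%E.
by rewrite fineK//; apply: integrable_fin_num => //; apply: bm_integrable; exact: bmf.
Qed.

Let b_approx phi e : subadditive_potential T phi ->
  (\forall n \near \oo, forall x, `|f n x - phi n x| <= n%:R * e) ->
  \forall n \near \oo, `|b n - n%:R^-1 * E (phi n)| <= e.
Proof.
move=> subphi fphi; near=> n.
have n0 : (0 < n)%N by near: n; exact: nbhs_infty_gt.
have bphi := subadditive_bm subphi n0; have bf := bmf n0.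
have fphin : forall x, `|f n x - phi n x| <= n%:R * e by near: n.
rewrite -mulrBr -expectB// normrM gtr0_norm ?invr_gt0 ?ltr0n//.
rewrite ler_pdivrMl ?ltr0n// ler_norml; apply/andP; split.
  rewrite -(expect_cst mu (- _)); apply: le_expect; [exact: bm_cst|exact: bmB|].
  by move=> x; have := fphin x; rewrite ler_norml => /andP[].
rewrite -[leRHS](expect_cst mu); apply: le_expect; [exact: bmB|exact: bm_cst|].
by move=> x; have := fphin x; rewrite ler_norml => /andP[].
Unshelve. all: by end_near. Qed.

Hypothesis Fmu : Fstar mu f <> -oo%E.

(** If the means of [phi] were unbounded below, [mean_eventually_le] would drive them to [-oo], and
    the means of [f] with them. *)
Let mean_bounded_below phi e : subadditive_potential T phi ->
  (\forall n \near \oo, forall x, `|f n x - phi n x| <= n%:R * e) ->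
  exists c, forall n, (0 < n)%N -> c <= n%:R^-1 * E (phi n).
Proof.
move=> subphi fphi; apply: contrapT => unbounded; apply: Fmu.
rewrite FstarE; apply/cvg_lim => //; apply/cvgeNyPle => M.
(* The margin [e] pays for replacing [f] by [phi], and 1 for passing from [m] to large [n]. *)
have [m m0 am] : exists2 m, (0 < m)%N & m%:R^-1 * E (phi m) < M - e - 1.
  apply: contrapT => h; apply: unbounded; exists (M - e - 1) => n n0.
  by rewrite leNgt; apply/negP => ?; apply: h; exists n.
near=> n; rewrite lee_fin.
have : `|b n - n%:R^-1 * E (phi n)| <= e by near: n; exact: b_approx.
have : n%:R^-1 * E (phi n) <= m%:R^-1 * E (phi m) + 1.
  near: n; apply: (mean_eventually_le mT ergmu.1) => //.
    exact: subadditive_bm.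
  exact: subadditive_mean_bound.
by rewrite ler_norml => ? /andP[? ?]; lra.
Unshelve. all: by end_near. Qed.

(** The two clauses serve the two pressure bounds. The lower bound only needs [f n] to be large at
    typical points, whereas the upper bound needs control at every point of a mistake ball, hence by
    ergodic sums of a continuous function. *)
Theorem potential_growth : exists2 l : R, Fstar mu f = l%:E &
  forall e, 0 < e ->
    vanishing mu (fun n => [set x : borel X | f n x < n%:R * (l - e)]) /\
    exists psi C, [/\ continuous psi, E psi < l + e &
      \forall n \near \oo, forall x, f n x <= bsum T psi n x + C + n%:R * e].
Proof.
have lims e : 0 < e -> exists phi lphi, [/\ subadditive_potential T phi,
    \forall n \near \oo, forall x, `|f n x - phi n x| <= n%:R * e,
    (forall n, (0 < n)%N -> lphi <= n%:R^-1 * E (phi n)),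
    (forall t, 0 < t -> exists2 m, (0 < m)%N & m%:R^-1 * E (phi m) < lphi + t) &
    \forall n \near \oo, `|lphi - b n| <= 2 * e].
  move=> e0; have [phi subphi fphi] := subadditive_approximation e0.
  have [c cphi] := mean_bounded_below subphi fphi.
  have [lphi lea infl] := exists_inf_adherent cphi.
  exists phi, lphi; split => //.
  have cvgphi : n%:R^-1 * E (phi n) @[n --> \oo] --> lphi.
    apply: (mean_cvg_inf mT ergmu.1) lea infl; first exact: subadditive_bm.
    exact: subadditive_mean_bound.
  near=> n.
  have : `|lphi - n%:R^-1 * E (phi n)| <= e.
    by near: n; apply: cvgr_dist_le => //; exact: cvgphi.
  have : `|b n - n%:R^-1 * E (phi n)| <= e by near: n; exact: b_approx.
  by rewrite !ler_norml => /andP[? ?] /andP[? ?]; lra.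
(* The numbers [lphi] of finer and finer approximations show that [b] is a Cauchy sequence. *)
have cvgb : cvg (b n @[n --> \oo]).
  apply/cauchy_cvgP/cauchy_exP => e e0.
  have [phi [lphi [_ _ _ _ bl]]] := lims (e / 3) (divr_gt0 e0 (ltr0Sn _ _)).
  exists lphi; near=> n; rewrite /ball /= (@le_lt_trans _ _ (2 * (e / 3)))//.
    by near: n.
  by lra.
pose l := lim (b n @[n --> \oo]); exists l.
  rewrite FstarE; apply/cvg_lim => //.
  by apply: cvg_EFin; [exact: nearW|exact: cvgb].
move=> e e0; have e80 : 0 < e / 8 by rewrite divr_gt0.
have [phi [lphi [subphi fphi lea infl bl]]] := lims _ e80.
have ll : `|l - lphi| <= 3 * (e / 8).
  have [n [bl1 bl2]] : exists n, `|lphi - b n| <= 2 * (e / 8) /\ `|l - b n| <= e / 8.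
    near \oo => n; exists n; split; near: n => //.
    by apply: cvgr_dist_le => //; exact: cvgb.
  move: bl1 bl2; rewrite !ler_norml => /andP[? ?] /andP[? ?].
  by apply/andP; split; lra.
move: ll; rewrite ler_norml => /andP[ll1 ll2]; split.
  have := concentration_below mT ergmu.1 (subadditive_bm subphi)
    (subadditive_mean_bound subphi) ergmu.2 lea infl e80.
  apply: vanishing_sub => [n n0|].
    by apply: measurable_lt; [case: (bmf n0)|exact: measurable_cst].
  near=> n => x /= fx.
  have n0 : (0 < n)%N by near: n; exact: nbhs_infty_gt.
  have n0R : (0 : R) < n%:R by rewrite ltr0n.
  have /(_ x) : forall x, `|f n x - phi n x| <= n%:R * (e / 8) by near: n.
  rewrite ler_norml => /andP[? ?].
  have : n%:R * (l - e) <= n%:R * (lphi - e / 8 - e / 8) by rewrite ler_pM2l//; lra.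
  by lra.
have [m m0 am] := infl _ e80.
have [C phiC] := subadditive_bound subphi m0.
exists (fun x => m%:R^-1 * phi m x), C; split.
- move=> x; apply: cvgM; first exact: cvg_cst.
  by case: subphi => /(_ m m0 x).
- by rewrite expectZ; [lra|exact: subadditive_bm].
near=> n => x.
have n0 : (0 < n)%N by near: n; exact: nbhs_infty_gt.
have n0R : (0 : R) < n%:R by rewrite ltr0n.
have /(_ x) : forall x, `|f n x - phi n x| <= n%:R * (e / 8) by near: n.
rewrite ler_norml => /andP[? ?]; have := phiC n x n0; rewrite bsumZ.
have : n%:R * (e / 8) <= n%:R * e by rewrite ler_pM2l//; lra.
by lra.
Unshelve. all: by end_near. Qed.

End potential.

(** * The two bounds *)

Section mistake_balls.
Context (R : realType) (X : pmetricType R) (T : X -> X) (g : nat -> R -> nat).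
Implicit Types (x y : X) (eps : R).

Lemma dist_on_lt n (L : {set 'I_n}) x y eps : 0 < eps ->
  (dist_on T L x y < eps) <->
  (forall i, i \in L -> mdist (iter i T x) (iter i T y) < eps).
Proof.
move=> eps0; split=> [/bigmax_ltP[_ h] i iL|h]; first exact: h.
exact/bigmax_ltP.
Qed.

Lemma mistake_ballP n x eps y : 0 < eps ->
  mistake_ball T g n x eps y <->
  exists L : {set 'I_n}, (n - g n eps <= #|L|)%N /\
    forall i, i \in L -> mdist (iter i T x) (iter i T y) < eps.
Proof.
move=> eps0; split=> [[L gL /(dist_on_lt _ _ _ eps0) xy]|[L [gL xy]]].
  by exists L.
by exists L => //; exact/(dist_on_lt _ _ _ eps0).
Qed.

Hypothesis contT : continuous T.

Lemma open_mistake_ball n x eps : 0 < eps ->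
  open (mistake_ball T g n x eps : set X).
Proof.
move=> eps0; apply: bigcup_open => L _.
rewrite openE => y /(dist_on_lt _ _ _ eps0) xy.
have : \forall z \near y, forall i : 'I_n,
    i \in L -> mdist (iter i T x) (iter i T z) < eps.
  apply: filter_forall => i; have [iL|_] := boolP (i \in L); last exact: nearW.
  have oi : open (iter i T @^-1` [set z | mdist (iter i T x) z < eps]).
    have /continuousP := @continuous_iter _ _ T i contT; apply.
    exact: open_mdist_lt.
  by apply: filterS (open_nbhs_nbhs (conj oi (xy i iL))) => z.
by apply: filterS => z xz; exact/(dist_on_lt _ _ _ eps0).
Qed.

Lemma measurable_mistake_balls n (S : set X) eps : 0 < eps ->
  measurable (\bigcup_(x in S) mistake_ball T g n x eps).
Proof.
move=> eps0; apply: borel_open; apply: bigcup_open => x _.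
exact: open_mistake_ball.
Qed.

End mistake_balls.

Lemma sum_notin (R : realType) n (L : {set 'I_n}) :
  \sum_(i < n) (i \notin L)%:R = (n - #|L|)%:R :> R.
Proof.
rewrite -natr_sum; congr (_%:R).
rewrite [RHS](_ : _ = #|~: L|)%N; last by rewrite [RHS]cardsCs finset.setCK card_ord.
by rewrite -sum1_card [RHS]big_mkcond/=; apply: eq_bigr => i _; rewrite inE; case: ifP.
Qed.

Section bounds.
Context (R : realType) (X : pmetricType R) (T : X -> X).
Context (mu : probability (borel X) R) (f : nat -> X -> R) (g : nat -> R -> nat).
Hypothesis compactX : compact [set: X].
Hypothesis contT : continuous T.
Hypothesis ergmu : ergodic_measure T mu.
Hypothesis few_mistakes : forall eps : R, 0 < eps ->
  (fun n => (g n eps)%:R / n%:R : R) @ \oo --> (0 : R).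
Context (l : R).

Notation E := (expect mu).
Notation P := (prob mu).
Notation Tb := (T : borel X -> borel X).

Let mT : measurable_fun [set: borel X] (T : borel X -> borel X).
Proof. exact: continuous_measurable_self. Qed.

Lemma mistakes_le (eps c : R) : 0 < eps -> 0 < c ->
  \forall n \near \oo, (g n eps)%:R <= n%:R * c.
Proof.
move=> eps0 c0; near=> n.
have n0 : (0 < n)%N by near: n; exact: nbhs_infty_gt.
have : `|0 - (g n eps)%:R / n%:R : R| <= c.
  by near: n; apply: cvgr_dist_le => //; exact: few_mistakes.
by rewrite sub0r normrN ger0_norm// ler_pdivrMr ?ltr0n// mulrC.
Unshelve. all: by end_near. Qed.

(** At times in [L] the value of [psi] changes by less than [e]; at the at most [g n eps] other
    times it changes by at most [2 * B]. *)
Lemma mistake_ball_bsum (psi : X -> R) (B r e eps : R) n x y :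
  0 < eps -> eps <= r ->
  (forall z, `|psi z| <= B) ->
  (forall z t, mdist z t < r -> `|psi z - psi t| < e) ->
  mistake_ball T g n x eps y ->
  bsum T psi n y <= bsum T psi n x + n%:R * e + (g n eps)%:R * (2 * B).
Proof.
move=> eps0 epsr psiB psir /(mistake_ballP _ _ _ _ _ eps0)[L [gL xy]].
have B0 : 0 <= B by rewrite (le_trans _ (psiB x)).
have r0 : 0 < r by exact: lt_le_trans epsr.
have e0 : 0 <= e by have := psir x x; rewrite mdistxx subrr normr0 => /(_ r0)/ltW.
apply: (@le_trans _ _ (bsum T psi n x +
    \sum_(i < n) (e + (i \notin L)%:R * (2 * B)))).
  rewrite /bsum -big_split/=; apply: ler_sum => i _.
  have [iL|iL] := boolP (i \in L).
    have := psir _ _ (lt_le_trans (xy i iL) epsr); rewrite ltr_norml => /andP[? ?].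
    by rewrite mul0r; lra.
  rewrite mul1r; have := psiB (iter i T x); have := psiB (iter i T y).
  by rewrite !ler_norml => /andP[? ?] /andP[? ?]; lra.
rewrite big_split/= -mulr_suml sum_notin sumr_const card_ord.
rewrite -[e *+ n]mulr_natl -addrA !lerD2l ler_wpM2r ?mulr_ge0// ler_nat.
by rewrite leq_subLR addnC -leq_subLR.
Qed.

(** Only off this null set does an upper bound on [info] give a lower bound on the mass of the
    cell. *)
Lemma null_words k (lab : borel X -> 'I_k) n :
  (forall c, measurable (lab @^-1` [set c])) ->
  measurable [set x : borel X | pw mu Tb lab (itin Tb lab n x) = 0] /\
  P [set x : borel X | pw mu Tb lab (itin Tb lab n x) = 0] = 0.
Proof.
move=> mlab; set A := [set x | _].
have AE : \1_A = (fun x => (pw mu Tb lab (itin Tb lab n x) == 0)%:R) :> (borel X -> R).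
  apply/funext => x; rewrite indicE; congr (nat_of_bool _)%:R.
  by apply/idP/eqP => [/set_mem|h]; [|exact/mem_set].
have mA : measurable A.
  suff : measurable_fun setT (\1_A : borel X -> R) by move/measurable_indicP.
  by rewrite AE; case: (bm_itin mT mlab n (fun s => (pw mu Tb lab s == 0)%:R : R)).
split=> //; rewrite -(expect_indic mu mA) AE.
rewrite (expect_itin mu mT mlab n (fun s => (pw mu Tb lab s == 0)%:R)).
by rewrite big1// => s _; case: eqP => [->|]; rewrite ?mulr0 ?mul0r.
Qed.

(** * Upper bound for the spanning pressure *)

Section upper_bound.
Hypothesis growth : forall e : R, 0 < e -> exists psi C,
  [/\ continuous psi, E psi < l + e &
      \forall n \near \oo, forall x, f n x <= bsum T psi n x + C + n%:R * e].

Theorem spanning_pressure_le h e delta : (ks_entropy T mu <= h%:E)%E ->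
  0 < e -> 0 < delta -> exists2 eps1, 0 < eps1 &
  forall eps, 0 < eps < eps1 -> \forall n \near \oo,
    (spanning_pressure T mu f g n eps delta <= (expR (n%:R * (h + l + e)))%:E)%E.
Proof.
(* One [c] will be spent on the number of centres and five on the supremum of [f n] over a ball. *)
move=> hE e0 delta0; pose c := e / 8; have c0 : 0 < c by rewrite divr_gt0.
have [psi [C [cpsi Epsi fpsi]]] := growth c0.
have [B psiB] := compact_continuous_bounded compactX cpsi.
have [r r0 psir] := compact_continuous_unif compactX cpsi c0.
exists r => // eps /andP[eps0 epsr].
have B0 : 0 <= B by rewrite (le_trans _ (psiB point)).
have [k [lab [mlab slab dlab]]] := exists_small_labelling compactX eps0.
have [h' h'E [lea infh']] := partition_entropy_inf mT ergmu.1 mlab.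
have hh' : h' <= h.
  rewrite -lee_fin (le_trans _ hE)// -h'E; apply: ereal_sup_ubound.
  exists k, (fun i => lab @^-1` [set i]); split => //.
  exact: labelling_partition.
have V1 := concentration_above mT ergmu.1 (fun n _ => bm_info mu mT mlab n)
  (info_almost_subadditive mT ergmu.1 mlab) ergmu.2 infh' c0.
have bpsi := continuous_bm compactX cpsi.
have V2 := birkhoff_above mT ergmu.1 ergmu.2 bpsi Epsi.
have [mV VP] := vanishingU V1 V2; have {}VP := VP _ delta0.
have [N _ fN] := fpsi.
have cB : 0 < c / (2 * B + 1) by rewrite divr_gt0//; lra.
near=> n.
have n0 : (0 < n)%N by near: n; exact: nbhs_infty_gt.
have n0R : (0 : R) < n%:R by rewrite ltr0n.
have {fN} fN x : f n x <= bsum T psi n x + C + n%:R * c.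
  by apply: fN => /=; near: n; exact: nbhs_infty_ge.
pose Z : set (borel X) := [set x : borel X | pw mu Tb lab (itin Tb lab n x) = 0].
have [mZ PZ] : measurable Z /\ P Z = 0 by exact: null_words.
pose Bad : set (borel X) := [set x | n%:R * (h' + c) < info mu Tb lab n x]
  `|` [set x | n%:R * (l + c) < bsum T psi n x].
have mBad : measurable Bad by exact: mV.
have PBad : P Bad < delta by rewrite /Bad; near: n; exact: VP.
pose Good := ~` (Bad `|` Z).
have mGood : measurable Good by apply: measurableC; exact: measurableU.
have PGood : 1 - delta < P Good.
  rewrite probC; last exact: measurableU.
  by rewrite ltrD2l ltrN2 (le_lt_trans (probU _ mBad mZ))// PZ addr0.
have goodP x : Good x ->
    [/\ expR (- (n%:R * (h' + c))) <= pw mu Tb lab (itin Tb lab n x)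
    & bsum T psi n x <= n%:R * (l + c)].
  move=> /not_orP[/not_orP[/negP + /negP +] /eqP Zx]; rewrite -!leNgt => ix Sx.
  split=> //; rewrite expR_info ?lt_neqAle ?pw_ge0 ?andbT 1?eq_sym//.
  by rewrite ler_expR lerN2.
(* The words of good points have mass bounded below, hence are few; [pt] chooses a good point for
   each, and these points are the centres. *)
pose W := [seq s <- words k n | `[< exists x, Good x /\ itin Tb lab n x = s >]].
have [pt ptW] : exists pt : seq 'I_k -> X, forall s, s \in W ->
    Good (pt s) /\ itin Tb lab n (pt s) = s.
  have /choice[pt ptP] : forall s, exists x, s \in W -> Good x /\ itin Tb lab n x = s.
    move=> s; have [|] := boolP (s \in W); last by exists point.
    by rewrite mem_filter => /andP[/asboolP[x xs] _]; exists x.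
  by exists pt.
have sizeW : (size W)%:R <= expR (n%:R * (h' + c)).
  rewrite -[X in expR X]opprK expRN.
  apply: le_trans (card_pw_ge mu mT mlab n _); last by rewrite expR_gt0.
  rewrite ler_nat size_filter; apply: sub_count => s /asboolP[x [Gx <-]].
  by have [] := goodP x Gx.
pose D := undup [seq pt s | s <- W].
(* The five [c] are for the ergodic sum at the good centre, the oscillation of [psi], the mistakes,
   the constant [C], and the error in bounding [f n] by an ergodic sum. *)
pose M := expR (n%:R * (l + 5 * c)).
have ball_le x : x \in D ->
    (expeR (ereal_sup [set (f n y)%:E | y in mistake_ball T g n x eps]) <= M%:E)%E.
  rewrite mem_undup => /mapP[s sW ->]; have [Gs _] := ptW s sW.
  have [_ Ss] := goodP _ Gs.
  rewrite -[M%:E]/(expeR (n%:R * (l + 5 * c))%:E) lee_expeR.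
  apply: ge_ereal_sup => _ [y xy <-]; rewrite lee_fin.
  apply: le_trans (fN y) _.
  have := mistake_ball_bsum eps0 (ltW epsr) psiB psir xy.
  have : (g n eps)%:R * (2 * B) <= n%:R * c.
    have : (g n eps)%:R <= n%:R * (c / (2 * B + 1)).
      by near: n; exact: mistakes_le.
    have B1 : 0 < 2 * B + 1 by lra.
    rewrite mulrA ler_pdivlMr//; apply: le_trans.
    by rewrite ler_wpM2l// lerDl.
  have : C <= n%:R * c by rewrite -ler_pdivrMr//; near: n; exact: nbhs_infty_ger.
  lra.
apply: (@le_trans _ _ (\esum_(x in [set` D])
    expeR (ereal_sup [set (f n y)%:E | y in mistake_ball T g n x eps]))).
  apply: ereal_inf_lbound; exists [set` D] => //=.
  rewrite /spanning (@lt_le_trans _ _ (P Good)%:E) ?lte_fin// -probE//.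
  apply: le_measure; rewrite ?inE//; first exact: measurable_mistake_balls.
  move=> x Gx; pose s := itin Tb lab n x.
  have sW : s \in W by rewrite mem_filter itin_words andbT; apply/asboolP; exists x.
  exists (pt s); first by rewrite /= mem_undup; apply: map_f.
  (* Equal itineraries keep the two orbits within [eps] at all times, so no mistake is made. *)
  apply/mistake_ballP => //; exists [set: 'I_n]%SET; split.
    by rewrite cardsT card_ord leq_subr.
  move=> i _; apply: dlab; have [_ pts] := ptW s sW.
  by rewrite -!(nth_itin _ _ (lab x) _ (ltn_ord i)) pts.
rewrite esum_fset; [|exact: finite_seq|by move=> x _; exact: expeR_ge0].
rewrite -fsbig_seq ?undup_uniq//.
apply: (@le_trans _ _ (\sum_(x <- D) M%:E)%E).
  by rewrite big_seq [leRHS]big_seq; apply: lee_sum => x; exact: ball_le.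
rewrite sumEFin lee_fin big_const_seq count_predT iter_addr_0.
have : (size D)%:R <= expR (n%:R * (h' + c)).
  by apply: le_trans sizeW; rewrite ler_nat -(size_map pt) size_undup.
rewrite -[M *+ _]mulr_natl => sD; apply: (@le_trans _ _ (expR (n%:R * (h' + c)) * M)).
  by rewrite ler_wpM2r// expR_ge0.
rewrite -expRD ler_expR -mulrDr ler_wpM2l//.
by rewrite /c; lra.
Unshelve. all: by end_near. Qed.

End upper_bound.
Lemma hamming_itin k (lab : borel X -> 'I_k) n x y :
  (hamming (itin Tb lab n x) (itin Tb lab n y))%:R =
  \sum_(i < n) (lab (iter i T x) != lab (iter i T y))%:R :> R.
Proof.
elim: n x y => [|n ih] x y; first by rewrite big_ord0.
rewrite /= natrD ih big_ord_recl; congr (_ + _); apply: eq_bigr => i _.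
by rewrite lift0 !iterSr.
Qed.

(** Labels can differ at time [i] only if one of the orbits is in [V] or [i] is a mistake for [x] or
    for [y]: otherwise both orbits are within [eps] of that of the centre [z], so closer than [r] to
    each other. *)
Lemma mistake_ball_hamming k (lab : borel X -> 'I_k) (V : set (borel X))
    r eps n z x y :
  0 < eps -> 2 * eps <= r ->
  (forall x y : X, ~ V x -> ~ V y -> mdist x y < r -> lab x = lab y) ->
  mistake_ball T g n z eps x -> mistake_ball T g n z eps y ->
  (hamming (itin Tb lab n x) (itin Tb lab n y))%:R <=
  bsum T \1_V n x + bsum T \1_V n y + 2 * (g n eps)%:R :> R.
Proof.
move=> eps0 epsr Vr /(mistake_ballP _ _ _ _ _ eps0)[L [gL zx]].
move=> /(mistake_ballP _ _ _ _ _ eps0)[L' [gL' zy]].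
have notin_le (K : {set 'I_n}) : (n - g n eps <= #|K|)%N ->
    \sum_(i < n) (i \notin K)%:R <= (g n eps)%:R :> R.
  by move=> gK; rewrite sum_notin ler_nat leq_subLR addnC -leq_subLR.
have -> : bsum T \1_V n x + bsum T \1_V n y + 2 * (g n eps)%:R =
    bsum T \1_V n x + bsum T \1_V n y + ((g n eps)%:R + (g n eps)%:R) :> R by lra.
apply: le_trans (lerD (lexx _) (lerD (notin_le L gL) (notin_le L' gL'))).
rewrite hamming_itin /bsum -!big_split/=; apply: ler_sum => i _; rewrite !indicE.
have [_|lxy] := eqVneq; first by rewrite !addr_ge0.
have mistake : V (iter i T x) \/ V (iter i T y) \/ i \notin L \/ i \notin L'.
  apply: contrapT => /not_orP[xV /not_orP[yV /not_orP[/negP iL /negP iL']]].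
  rewrite !negbK in iL iL'; move/eqP : lxy; apply; apply: Vr => //.
  apply: le_lt_trans (metric_triangle _ (iter i T z) _) _.
  by rewrite metric_sym; have := zx i iL; have := zy i iL'; lra.
have b0 (b : bool) : 0 <= b%:R :> R by exact: ler0n.
have := b0 (iter i T x \in V); have := b0 (iter i T y \in V).
have := b0 (i \notin L); have := b0 (i \notin L').
by case: mistake => [/mem_set ->|[/mem_set ->|[->|->]]] ? ? ? ?; rewrite /=; lra.
Qed.

(** * Lower bound for the spanning pressure *)

Section lower_bound.
Context (k : nat) (lab : borel X -> 'I_k) (h : R).
Hypothesis mlab : forall c, measurable (lab @^-1` [set c]).
Hypothesis lea : forall n, (0 < n)%N -> h <= n%:R^-1 * E (info mu Tb lab n).
Hypothesis infh : forall e, 0 < e -> exists2 m, (0 < m)%N &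
  m%:R^-1 * E (info mu Tb lab m) < h + e.
Hypothesis growth : forall e : R, 0 < e ->
  vanishing mu (fun n => [set x : borel X | f n x < n%:R * (l - e)]).

Theorem spanning_pressure_ge (e delta : R) : 0 < e -> 0 < delta < 1 ->
  exists2 eps1, 0 < eps1 & forall eps, 0 < eps < eps1 ->
  \forall n \near \oo,
    ((expR (n%:R * (h + l - e)))%:E <= spanning_pressure T mu f g n eps delta)%E.
Proof.
move=> e0 /andP[delta0 delta1]; pose c := e / 4; have c0 : 0 < c by rewrite divr_gt0.
have [t t0 ham_t] := hamming_ball_small k c0.
(* Two good orbits spend at most [n%:R * (t / 8)] each in [V], and the mistakes of both add at most
   [n%:R * (t / 2)], which stays within the Hamming radius [n%:R * t]. *)
have t80 : 0 < t / 8 by rewrite divr_gt0.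
have [V [mV PV [r r0 Vr]]] := labelling_nearly_uniform mu mlab t80.
exists (r / 2) => [|eps /andP[eps0 epsr]]; first by rewrite divr_gt0.
have epsr2 : 2 * eps <= r by lra.
have V1 := concentration_below mT ergmu.1 (fun n _ => bm_info mu mT mlab n)
  (info_almost_subadditive mT ergmu.1 mlab) ergmu.2 lea infh c0.
have V2 := growth c0.
have bV : bounded_measurable (\1_V : borel X -> R) by exact: bm_indic.
have EV : E (\1_V) < t / 8 by rewrite expect_indic.
have V3 := birkhoff_above mT ergmu.1 ergmu.2 bV EV.
have [mBadn VP] := vanishingU (vanishingU V1 V2) V3.
have d20 : 0 < (1 - delta) / 2 by rewrite divr_gt0// subr_gt0.
have {}VP := VP _ d20.
have t40 : 0 < t / 4 by rewrite divr_gt0.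
near=> n.
have n0 : (0 < n)%N by near: n; exact: nbhs_infty_gt.
have n0R : (0 : R) < n%:R by rewrite ltr0n.
have few : (g n eps)%:R <= n%:R * (t / 4) by near: n; exact: mistakes_le.
pose Bad : set (borel X) := [set x | info mu Tb lab n x < n%:R * (h - c)]
  `|` [set x | f n x < n%:R * (l - c)]
  `|` [set x | n%:R * (t / 8) < bsum T \1_V n x].
have mBad : measurable Bad by exact: mBadn.
have PBad : P Bad < (1 - delta) / 2 by rewrite /Bad; near: n; exact: VP.
have goodP x : ~ Bad x -> [/\ n%:R * (h - c) <= info mu Tb lab n x,
    n%:R * (l - c) <= f n x & bsum T \1_V n x <= n%:R * (t / 8)].
  by move=> /not_orP[/not_orP[/negP + /negP +] /negP]; rewrite -!leNgt.
apply: le_ereal_inf_tmp => _ [S spanS <-].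
pose ball x : set (borel X) := mistake_ball T g n x eps.
pose U : set (borel X) := \bigcup_(x in S) ball x.
have mU : measurable U by exact: measurable_mistake_balls.
have PU : 1 - delta < P U by move: spanS; rewrite /= /spanning (probE mu mU) lte_fin.
(* Words of the good points covered by the balls; [pt] assigns to each word a centre in [S] and a
   good point of its ball. *)
pose W := [seq s <- words k n |
  `[< exists xy : X * X, [/\ S xy.1, ball xy.1 xy.2, ~ Bad xy.2
    & itin Tb lab n xy.2 = s] >]].
have [pt ptW] : exists pt : seq 'I_k -> X * X, forall s, s \in W ->
    [/\ S (pt s).1, ball (pt s).1 (pt s).2, ~ Bad (pt s).2
      & itin Tb lab n (pt s).2 = s].
  have /choice[pt ptP] : forall s, exists xy : X * X, s \in W ->
      [/\ S xy.1, ball xy.1 xy.2, ~ Bad xy.2 & itin Tb lab n xy.2 = s].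
    move=> s; have [|] := boolP (s \in W); last by exists point.
    by rewrite mem_filter => /andP[/asboolP[xy xys] _]; exists xy.
  by exists pt.
have subW s : s \in W -> s \in words k n by rewrite mem_filter => /andP[].
pose D := undup [seq (pt s).1 | s <- W].
have DS : [set` D] `<=` S.
  by move=> x /=; rewrite mem_undup => /mapP[s /ptW[Sx _ _ _] ->].
(* All words assigned to one centre lie in a Hamming ball around any one of them. *)
have size_fiber x : x \in D ->
    (count (fun s => (pt s).1 == x) W)%:R <= expR (n%:R * c).
  rewrite mem_undup => /mapP[s0 s0W xE].
  have [_ ball0 Bad0 it0] := ptW s0 s0W.
  have sz0 : size s0 = n by have := subW _ s0W; rewrite mem_words => /eqP.
  have := ham_t s0; rewrite sz0; apply: le_trans; rewrite ler_nat.
  rewrite -!size_filter; apply: uniq_leq_size.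
    by rewrite !filter_uniq// uniq_words.
  move=> s; rewrite mem_filter => /andP[/eqP sx sW]; rewrite mem_filter subW// andbT.
  have [_ balls Bads its] := ptW s sW.
  rewrite -it0 -its; rewrite xE in sx; rewrite sx in balls.
  apply: (le_trans (mistake_ball_hamming eps0 epsr2 Vr ball0 balls)).
  have [_ _ ?] := goodP _ Bad0; have [_ _ ?] := goodP _ Bads.
  by have := mulr_ge0 (ltW n0R) (ltW t0); lra.
have sizeW : (size W)%:R <= (size D)%:R * expR (n%:R * c).
  have -> : (size W)%:R = \sum_(x <- D) (count (fun s => (pt s).1 == x) W)%:R :> R.
    rewrite -natr_sum; congr (_%:R).
    under eq_bigr do rewrite -sum1_count big_mkcond/=.
    rewrite exchange_big/= -sum1_size big_seq [RHS]big_seq; apply: eq_bigr => s sW.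
    have sD : (pt s).1 \in D by rewrite mem_undup; apply: map_f.
    rewrite (bigD1_seq _ sD (undup_uniq _))/= eqxx big1 ?addn0// => x xs.
    by rewrite eq_sym (negbTE xs).
  have -> : (size D)%:R * expR (n%:R * c) = \sum_(x <- D) expR (n%:R * c).
    by rewrite big_const_seq count_predT iter_addr_0 mulr_natl.
  rewrite big_seq [leRHS]big_seq; apply: ler_sum => x; exact: size_fiber.
have pwW s : s \in W -> pw mu Tb lab s <= expR (- (n%:R * (h - c))).
  move=> /ptW[_ _ /goodP[+ _ _]]; move: (pt s).2 => y iy <-.
  have := pw_ge0 mu Tb lab (itin Tb lab n y); rewrite le_eqVlt.
  by move=> /predU1P[<-|py]; rewrite ?expR_ge0// expR_info// ler_expR lerN2.
have PUBad : P (U `\` Bad) <= (size W)%:R * expR (- (n%:R * (h - c))).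
  apply: (@le_trans _ _ (\sum_(s <- words k n) (s \in W)%:R * pw mu Tb lab s)).
    rewrite -(expect_itin mu mT mlab n (fun s => (s \in W)%:R)).
    have mUB : measurable (U `\` Bad) by exact: measurableD.
    rewrite -(expect_indic mu mUB); apply: le_expect; first exact: bm_indic.
      exact: (bm_itin mT mlab n (fun s => (s \in W)%:R)).
    move=> x; rewrite indicE; have [/set_mem[[z Sz zx] Bx]|_] := boolP (x \in _ `\` _).
      rewrite mem_filter itin_words andbT; case: asboolP => // nW; exfalso.
      by apply: nW; exists (z, x).
    by rewrite ler0n.
  apply: (@le_trans _ _ (\sum_(s <- words k n)
      (s \in W)%:R * expR (- (n%:R * (h - c))))).
    apply: ler_sum => s _; case: (boolP (s \in W)) => [sW|_]; last by rewrite !mul0r.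
    by rewrite !mul1r pwW.
  rewrite -mulr_suml ler_wpM2r ?expR_ge0// -natr_sum ler_nat.
  rewrite -big_mkcond/= sum1_count -size_filter; apply: uniq_leq_size.
    by rewrite filter_uniq// uniq_words.
  by move=> s; rewrite mem_filter => /andP[].
have dn : expR (- (n%:R * c)) <= (1 - delta) / 2.
  rewrite -[leRHS]lnK ?posrE// ler_expR lerNl -ler_pdivrMr//.
  by near: n; exact: nbhs_infty_ger.
have half : (1 - delta) / 2 < P (U `\` Bad).
  have mUB := measurableD mU mBad; have := probU mu mUB mBad.
  have : P U <= P (U `\` Bad `|` Bad).
    apply: le_prob => //; first exact: measurableU.
    by move=> x Ux; have [?|?] := pselect (Bad x); [right|left].
  lra.
(* One [c] comes from the mass of [U] off [Bad], one from the mass of a cell, and one from the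
   number of words per centre. *)
have sizeD : expR (n%:R * (h - 3 * c)) <= (size D)%:R.
  have nc0 := expR_gt0 (n%:R * c); have nh0 := expR_gt0 (- (n%:R * (h - c))).
  rewrite -(ler_pM2r nc0); apply: le_trans sizeW.
  rewrite -(ler_pM2r nh0); apply: le_trans PUBad.
  apply: le_trans (ltW half); apply: le_trans dn.
  by rewrite -!expRD ler_expR; lra.
(* [S] may be infinite, but the finitely many centres in [D] suffice, each ball containing a good
   point where [f n] is large. *)
apply: esum_ge; exists [set` D]; first by split => //; exact: finite_seq.
rewrite -fsbig_seq ?undup_uniq//.
apply: (@le_trans _ _ (\sum_(x <- D) (expR (n%:R * (l - c)))%:E)%E); last first.
  rewrite big_seq [leRHS]big_seq; apply: lee_sum => x.
  rewrite mem_undup => /mapP[s /ptW[_ xs /goodP[_ fs _] _] ->].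
  rewrite -[(expR _)%:E]/(expeR (n%:R * (l - c))%:E) lee_expeR.
  apply: (@le_trans _ _ (f n (pt s).2)%:E); first by rewrite lee_fin.
  by apply: ereal_sup_ubound; exists (pt s).2.
rewrite sumEFin lee_fin big_const_seq count_predT iter_addr_0.
rewrite -[expR _ *+ _]mulr_natl.
apply: (@le_trans _ _ (expR (n%:R * (h - 3 * c)) * expR (n%:R * (l - c)))).
  by rewrite -expRD ler_expR -mulrDr ler_wpM2l// /c; lra.
by rewrite ler_wpM2r// expR_ge0.
Unshelve. all: by end_near. Qed.

End lower_bound.
End bounds.

(** * The theorem *)

Section limits.
Context (R : realType).
Local Open Scope ereal_scope.

Lemma limn_esup_le_near (u : nat -> \bar R) (c : \bar R) :
  (\forall n \near \oo, u n <= c) -> limn_esup u <= c.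
Proof.
move=> uc; apply: (@le_trans _ _ (ereal_sup [set u n | n in [set n | u n <= c]])).
  by apply: ereal_inf_lbound; exists [set n | u n <= c].
by apply: ge_ereal_sup => _ [n /= un <-].
Qed.

Lemma limn_einf_ge_near (u : nat -> \bar R) (c : \bar R) :
  (\forall n \near \oo, c <= u n) -> c <= limn_einf u.
Proof.
move=> uc; rewrite /limn_einf leeNr; apply: limn_esup_le_near.
by apply: filterS uc => n; rewrite leeN2.
Qed.

(** Testing against real bounds treats finite and infinite limits alike, as the entropy may be
    [+oo]. *)
Lemma cvg_ereal_order (I : Type) (F : set_system I) (FF : Filter F)
    (u : I -> \bar R) (v : \bar R) :
  (forall b : R, b%:E < v -> \forall i \near F, b%:E <= u i) ->
  (forall b : R, v < b%:E -> \forall i \near F, u i <= b%:E) ->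
  u @ F --> v.
Proof.
case: v => [r| |] lo up.
- have near_r (e : R) : (0 < e)%R ->
      \forall i \near F, (r - e)%:E <= u i /\ u i <= (r + e)%:E.
    move=> e0; apply: filterI.
      by apply: lo; rewrite lte_fin ltrBlDr ltrDl.
    by apply: up; rewrite lte_fin ltrDl.
  apply/fine_cvgP; split.
    apply: filterS (near_r 1%R ltr01) => i [h1 h2].
    by rewrite fin_numE; apply/andP; split; apply/eqP => ui; move: h1 h2; rewrite ui.
  apply/cvgrPdist_le => e e0; apply: filterS (near_r e e0) => i [] /=.
  case: (u i) => //= s; rewrite !lee_fin => h1 h2.
  by rewrite ler_norml; apply/andP; split; lra.
- by apply/cvgeyPge => M; apply: lo; exact: ltry.
- by apply/cvgeNyPle => M; apply: up; exact: ltNyr.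
Qed.

End limits.

Section pressure.
Context (R : realType) (X : pmetricType R) (T : X -> X).
Context (f : nat -> X -> R) (mu : probability (borel X) R).
Hypothesis compactX : compact [set: X].
Hypothesis contT : continuous T.
Hypothesis asf : asymp_subadditive_potential T f.
Hypothesis ergmu : ergodic_measure T mu.
Hypothesis Fmu : Fstar mu f <> -oo%E.
Context (eps0 : R) (g : nat -> R -> nat).
Hypothesis mg : mistake_function eps0 g.
Local Open Scope ereal_scope.

Notation G := (mistake_ext eps0 g).
Notation V := (ks_entropy T mu + Fstar mu f).

Let mT : measurable_fun [set: borel X] (T : borel X -> borel X).
Proof. exact: continuous_measurable_self. Qed.

Lemma mistake_ext_cvg (eps : R) : (0 < eps)%R ->
  ((G n eps)%:R / n%:R : R)%R @[n --> \oo] --> (0 : R)%R.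
Proof.
move=> e0; have [eps00 /(_ (Num.min eps eps0))] := mg.
by rewrite lt_min e0 eps00 ge_min lexx orbT => /(_ isT)[].
Qed.

Lemma spanning_pressure_ge0 n (eps delta : R) :
  0 <= spanning_pressure T mu f G n eps delta.
Proof.
apply: le_ereal_inf_tmp => _ [S _ <-]; apply: esum_ge0 => x _.
exact: expeR_ge0.
Qed.

Lemma pressure_rate_ge (delta b : R) : (0 < delta < 1)%R -> b%:E < V ->
  \forall eps \near 0^'+, b%:E <= pressure_rate (@limn_einf R) T mu f G delta eps.
Proof.
move=> delta01; have [l lE growth] := potential_growth compactX contT asf ergmu Fmu.
(* A single partition suffices for a given [b], and its entropy is real even when the supremum is
   infinite. *)
rewrite lE -lteBlDr// => /ereal_sup_gt[_ [k [A [+ ->]]]].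
move=> /partition_labelling[lab [mlab ->]].
have [h -> [lea infh]] := partition_entropy_inf mT ergmu.1 mlab.
rewrite -EFinB lte_fin => bh.
have e0 : (0 < h + l - b)%R by lra.
have [eps1 eps10 span] := spanning_pressure_ge contT ergmu mistake_ext_cvg mlab
  lea infh (fun e he => (growth e he).1) e0 delta01.
near=> eps; apply: limn_einf_ge_near; near=> n.
have n0 : (0 < n)%N by near: n; exact: nbhs_infty_gt.
have n0R : (0 < n%:R :> R)%R by rewrite ltr0n.
have : (expR (n%:R * (h + l - (h + l - b))))%R%:E
    <= spanning_pressure T mu f G n eps delta.
  near: n; apply: span; apply/andP; split.
    by near: eps; exact: nbhs_right_gt.
  by near: eps; exact: nbhs_right_lt.
rewrite opprB addrC subrK => le_span.
rewrite (_ : b%:E = (n%:R^-1)%:E * (n%:R * b)%R%:E); last first.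
  by rewrite -EFinM mulrA mulVf ?gt_eqF// mul1r.
apply: lee_wpmul2l; first by rewrite lee_fin invr_ge0.
have P0 := spanning_pressure_ge0 n eps delta.
by rewrite -[leLHS]expeRK lee_lne// in_itv/= leey ?P0// lee_fin expR_ge0.
Unshelve. all: by end_near. Qed.

Lemma pressure_rate_le (delta b : R) : (0 < delta < 1)%R -> V < b%:E ->
  \forall eps \near 0^'+, pressure_rate (@limn_esup R) T mu f G delta eps <= b%:E.
Proof.
move=> /andP[delta0 _].
have [l lE growth] := potential_growth compactX contT asf ergmu Fmu.
rewrite lE -lteBrDr// -EFinB => ksb.
(* As an extended real the supremum might be [-oo]; then any real below [b - l] serves. *)
have [h ksh hb] : exists2 h : R, ks_entropy T mu <= h%:E & (h < b - l)%R.
  case: (ks_entropy T mu) ksb => [r| |] //=.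
    by rewrite lte_fin => rb; exists r.
  by move=> _; exists (b - l - 1)%R; [exact: leNye|rewrite ltrBlDr ltrDl].
have e0 : (0 < b - l - h)%R by lra.
have [eps1 eps10 span] := spanning_pressure_le compactX contT ergmu
  mistake_ext_cvg (fun e he => (growth e he).2) ksh e0 delta0.
near=> eps; apply: limn_esup_le_near; near=> n.
have n0 : (0 < n)%N by near: n; exact: nbhs_infty_gt.
have n0R : (0 < n%:R :> R)%R by rewrite ltr0n.
have : spanning_pressure T mu f G n eps delta
    <= (expR (n%:R * (h + l + (b - l - h))))%R%:E.
  near: n; apply: span; apply/andP; split.
    by near: eps; exact: nbhs_right_gt.
  by near: eps; exact: nbhs_right_lt.
have -> : (h + l + (b - l - h) = b)%R by lra.
move=> le_span; rewrite (_ : b%:E = (n%:R^-1)%:E * (n%:R * b)%R%:E); last first.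
  by rewrite -EFinM mulrA mulVf ?gt_eqF// mul1r.
apply: lee_wpmul2l; first by rewrite lee_fin invr_ge0.
have P0 := spanning_pressure_ge0 n eps delta.
by rewrite -[leRHS]expeRK lee_lne// in_itv/= leey ?P0// lee_fin expR_ge0.
Unshelve. all: by end_near. Qed.

(** [Lim] lies between [limn_einf] and [limn_esup], so the lower estimate for the former and the
    upper estimate for the latter settle both cases at once. *)
Lemma pressure_rate_cvg Lim (delta : R) :
  Lim = @limn_einf R \/ Lim = @limn_esup R -> (0 < delta < 1)%R ->
  pressure_rate Lim T mu f G delta eps @[eps --> 0^'+] --> V.
Proof.
move=> LimE delta01; have le_Lim u : limn_einf u <= Lim u <= limn_esup u.
  by case: LimE => ->; rewrite lexx ?andbT limn_einf_sup.
apply: cvg_ereal_order => b bV.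
  apply: filterS (pressure_rate_ge delta01 bV) => eps /le_trans; apply.
  by case/andP: (le_Lim (fun n =>
    (n%:R^-1)%:E * lne (spanning_pressure T mu f G n eps delta))).
apply: filterS (pressure_rate_le delta01 bV) => eps; apply: le_trans.
by case/andP: (le_Lim (fun n =>
  (n%:R^-1)%:E * lne (spanning_pressure T mu f G n eps delta))).
Qed.

Lemma pressure_deltaE Lim (delta : R) :
  Lim = @limn_einf R \/ Lim = @limn_esup R -> (0 < delta < 1)%R ->
  pressure_delta Lim T mu f G delta = V.
Proof. by move=> LimE delta01; apply/cvg_lim => //; exact: pressure_rate_cvg. Qed.

Lemma pressure_delta_cvg Lim : Lim = @limn_einf R \/ Lim = @limn_esup R ->
  pressure_delta Lim T mu f G delta @[delta --> 0^'+] --> V.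
Proof.
move=> LimE; apply: cvg_near_cst; near=> delta.
by apply: pressure_deltaE => //; apply/andP; split; near: delta;
  [exact: nbhs_right_gt|exact: nbhs_right_lt].
Unshelve. all: by end_near. Qed.

End pressure.

Unset Implicit Arguments.

Theorem theoremA (R : realType) (X : pmetricType R) (T : X -> X)
    (f : nat -> X -> R) (mu : probability (borel X) R)
    (compactX : compact [set: X]) (contT : continuous T)
    (asf : asymp_subadditive_potential T f)
    (ergmu : ergodic_measure T mu)
    (Fmu : Fstar mu f <> -oo%E) :
  (forall Lim : (nat -> \bar R) -> \bar R,
    Lim = @limn_einf R \/ Lim = @limn_esup R ->
    (forall (eps0 : R) (g : nat -> R -> nat), mistake_function eps0 g ->
      let G := mistake_ext eps0 g in
      (forall delta : R, 0 < delta < 1 ->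
        [/\ cvg (pressure_rate Lim T mu f G delta eps @[eps --> 0^'+]),
            measure_pressure Lim T mu f G = pressure_delta Lim T mu f G delta
          & pressure_delta Lim T mu f G delta
            = (ks_entropy T mu + Fstar mu f)%E]) /\
      cvg (pressure_delta Lim T mu f G delta @[delta --> 0^'+])) /\
    (forall (eps0 eps1 : R) (g0 g1 : nat -> R -> nat) (delta0 delta1 : R),
      mistake_function eps0 g0 -> mistake_function eps1 g1 ->
      0 < delta0 < 1 -> 0 < delta1 < 1 ->
      pressure_delta Lim T mu f (mistake_ext eps0 g0) delta0
      = pressure_delta Lim T mu f (mistake_ext eps1 g1) delta1)).
Proof.
move=> Lim LimE; split => [eps0 g mg G|eps0 eps1 g0 g1 delta0 delta1 mg0 mg1 d0 d1].
  have cvgV := pressure_delta_cvg compactX contT asf ergmu Fmu mg LimE.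
  split=> [delta delta01|]; last by apply/cvg_ex; eexists; exact: cvgV.
  have deltaE := pressure_deltaE compactX contT asf ergmu Fmu mg LimE delta01.
  split=> //.
    by apply/cvg_ex; eexists; exact: (pressure_rate_cvg _ _ _ _ _ mg).
  by rewrite deltaE; apply/cvg_lim.
by rewrite !pressure_deltaE.
Qed.
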